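(* Let $\{(\mathcal H_m,\varphi_{n,m})\}_{m\le n\in I}$ be a direct system of Hilbert spaces with direct limit $(\mathcal H_\infty,\psi_m)$. For each $m\in I$ let $(\sigma_m,T_{m,1},\dots,T_{m,k})$ be a doubly twisted isometric covariant representation of the product system $\mathbb E=\{E_i\}_{i=1}^k$ on $\mathcal H_m$, with twists $\{t_{ij}\otimes U_{m,ij}\}_{i\ne j}$. Assume that for all $m\le n$, $a\in\mathcal A$, $i\in I_k$ and all $i\neq j$, $$\varphi_{n,m}\widetilde T_{m,i}=\widetilde T_{n,i}(I_{E_i}\otimes\varphi_{n,m}),\quad\varphi_{n,m}U_{m,ij}=U_{n,ij}\varphi_{n,m},\quad\varphi_{n,m}\sigma_m(a)=\sigma_n(a)\varphi_{n,m}.$$ Then there exists a twisted isometric covariant representation $(\sigma_\infty,T_{\infty,1},\dots,T_{\infty,k})$ of $\mathbb E$ on $\mathcal H_\infty$, together with unitaries $\{U_{\infty,ij}\}_{i\ne j}$ such that $\{t_{ij}\otimes U_{\infty,ij}\}_{i\ne j}$ are the corresponding twists, satisfying: (1) for every $m\in I$, $a\in\mathcal A$, $i\neq j$: $\psi_m\widetilde T_{m,i}=\widetilde T_{\infty,i}(I_{E_i}\otimes\psi_m)$, $\psi_mU_{m,ij}=U_{\infty,ij}\psi_m$, $\psi_m\sigma_m(a)=\sigma_\infty(a)\psi_m$; equivalently (identifying $\mathcal H_m$ with $\psi_m(\mathcal H_m)$) $T_{\infty,i}(x_i)|_{\mathcal H_m}=T_{m,i}(x_i)$, $U_{\infty,ij}|_{\mathcal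 H_m}=U_{m,ij}$, $\sigma_\infty(a)|_{\mathcal H_m}=\sigma_m(a)$ for $x_i\in E_i$. (2) If $j\in I_k$ is such that for every $m\in I$ there exists $n>m$ with $\widetilde T_{n,j}\widetilde T_{n,j}^*\varphi_{n,m}=\varphi_{n,m}$, then $(\sigma_\infty,T_{\infty,j})$ is fully coisometric. Moreover, if $\widetilde T_{n,j}\widetilde T_{n,j}^*=I_{\mathcal H_n}$ for all $n\in I$, then $\widetilde T_{\infty,j}$ is a coisometry. In particular, if either of these conditions holds for every $j\in I_k$, the representation $(\sigma_\infty,T_{\infty,1},\dots,T_{\infty,k})$ is fully coisometric, and hence doubly twisted.
   Context: Hilbert spaces are complex. $I_k=\{1,\dots,k\}$; $\mathcal A$ is a $C^*$-algebra. A $C^*$-correspondence $E$ over $\mathcal A$ is a right Hilbert $\mathcal A$-module with nondegenerate left action $\varphi:\mathcal A\to\mathcal L(E)$, $a\xi:=\varphi(a)\xi$, $\overline{\mathrm{span}}\,\varphi(\mathcal A)E=E$. Tensor products of correspondences are balanced over $\mathcal A$. $E\otimes_\sigma\mathcal H$ (also $E\otimes\mathcal H$) is the completion with $\langle\xi\otimes h,\eta\otimes k\rangle=\langle h,\sigma(\langle\xi,\eta\rangle)k\rangle$. A product system over $\mathbb Z_+^k$: $C^*$-correspondences $E_1,\dots,E_k$ over $\mathcal A$ with unitary bimodule isomorphisms $t_{ij}:E_i\otimes E_j\to E_j\otimes E_i$, $t_{ij}=t_{ji}^{-1}$, $t_{ii}=\mathrm{id}$, satisfying $(I_{E_\ell}\otimes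 t_{ij})(t_{i\ell}\otimes I_{E_j})(I_{E_i}\otimes t_{j\ell})=(t_{j\ell}\otimes I_{E_i})(I_{E_j}\otimes t_{i\ell})(t_{ij}\otimes I_{E_\ell})$ for distinct $i,j,\ell$. Twisted isometric representation on $\mathcal H$ with twists $\{t_{ij}\otimes U_{ij}\}$: $\sigma$ a nondegenerate representation of $\mathcal A$ on $\mathcal H$, $T_i:E_i\to\mathcal B(\mathcal H)$ linear completely contractive with $T_i(a\xi b)=\sigma(a)T_i(\xi)\sigma(b)$, $\widetilde T_i(\xi\otimes h)=T_i(\xi)h$ an isometry $E_i\otimes_\sigma\mathcal H\to\mathcal H$, and unitaries $U_{ij}$ with $U_{ji}=U_{ij}^*$, $U_{ij}\widetilde T_\ell=\widetilde T_\ell(I_{E_\ell}\otimes U_{ij})$, $U_{ij}\sigma(a)=\sigma(a)U_{ij}$, such that $\widetilde T_i(I_{E_i}\otimes\widetilde T_j)=\widetilde T_j(I_{E_j}\otimes\widetilde T_i)(t_{ij}\otimes U_{ij})$ for $i\neq j$. Doubly twisted: also $\widetilde T_j^*\widetilde T_i=(I_{E_j}\otimes\widetilde T_i)(t_{ij}\otimes U_{ij})(I_{E_i}\otimes\widetilde T_j^* )$ for $i\ne j$. $(\sigma,T_j)$ is fully coisometric if $\widetilde T_j\widetilde T_j^*=I_{\mathcal H}$; the whole representation is fully coisometric if this holds for all $j$. Direct system: $I$ is a nonempty directed set, $\varphi_{n,m}:\mathcal H_m\to\mathcal H_n$ ($m\le n$) are isometries with $\varphi_{l,n}\varphi_{n,m}=\varphi_{l,m}$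 and $\varphi_{m,m}=\mathrm{id}$. The direct limit is a Hilbert space $\mathcal H_\infty$ with isometries $\psi_m:\mathcal H_m\to\mathcal H_\infty$ with $\psi_n\varphi_{n,m}=\psi_m$, universal for compatible families of contractions into a Hilbert space; $\bigcup_m\psi_m(\mathcal H_m)$ is dense in $\mathcal H_\infty$. *)

(* Defs.v *)
From HB Require Import structures.
From mathcomp Require Import all_boot all_order all_algebra.
From mathcomp Require Import boolp classical_sets functions reals topology.
From mathcomp Require Import normedtype complex.

Set Implicit Arguments.
Unset Strict Implicit.
Unset Printing Implicit Defensive.

Import Order.TTheory GRing.Theory Num.Theory.
Import numFieldNormedType.Exports.

Local Open Scope classical_set_scope.
Local Open Scope ring_scope.

Lemma complex_norm_Re (R : realType) (z : R[i]) :
  (`|complex.Re z|)%:C%C <= `|z|.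
Proof.
rewrite normc_def lecR /= -sqrtr_sqr.
by rewrite ler_wsqrtr // lerDl sqr_ge0.
Qed.

Lemma complex_norm_Im (R : realType) (z : R[i]) :
  (`|complex.Im z|)%:C%C <= `|z|.
Proof.
rewrite normc_def lecR /= -sqrtr_sqr.
by rewrite ler_wsqrtr // lerDr sqr_ge0.
Qed.

Lemma complex_norm_le (R : realType) (z : R[i]) :
  `|z| <= (`|complex.Re z| + `|complex.Im z|)%:C%C.
Proof.
rewrite normc_def lecR.
rewrite -[leRHS]ger0_norm ?addr_ge0 // -[leRHS]sqrtr_sqr ler_wsqrtr //.
rewrite sqrrD !real_normK ?num_real // [leRHS]addrAC lerDl.
by rewrite mulrn_wge0 // mulr_ge0.
Qed.

Lemma complex_complete (R : realType) (F : set_system R[i]^o) :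
  ProperFilter F -> cauchy F -> cvg F.
Proof.
move=> FF /cauchy_ballP Fc.
have part (p : R[i] -> R) : {morph p : x y / x - y} ->
    (forall z, (`|p z|)%:C%C <= `|z|) -> cvg (p @ F).
  move=> pB ple; apply/cauchy_cvgP/cauchy_ballP => e e0; near_simpl.
  have e0' : (0 : R[i]) < e%:C%C by rewrite ltcR.
  have := Fc _ e0'; near_simpl.
  apply: filterS => -[x y] /=; rewrite -!ball_normE /= => h.
  by rewrite -pB -ltcR (le_lt_trans (ple _)).
have /cvg_ex[/= a Fa] := part _ (fun x y => raddfB (@complex.Re R) x y) (@complex_norm_Re R).
have /cvg_ex[/= b Fb] := part _ (fun x y => raddfB (@complex.Im R) x y) (@complex_norm_Im R).
apply/cvg_ex; exists (Complex a b); apply/cvgrPdist_lt => e e0.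
have [r r0 re] : exists2 r : R, 0 < r & e = r%:C%C.
  exists (complex.Re e); first by rewrite -ltcR RRe_real ?gtr0_real.
  by rewrite RRe_real ?gtr0_real.
have r2 : 0 < r / 2 by rewrite divr_gt0.
near=> z; rewrite re; apply: le_lt_trans (complex_norm_le _) _.
rewrite ltcR [ltRHS]splitr ltrD //.
  have : `|a - complex.Re z| < r / 2.
    by near: z; move/cvgrPdist_lt : Fa => /(_ _ r2).
  by case: (z).
have : `|b - complex.Im z| < r / 2.
  by near: z; move/cvgrPdist_lt : Fb => /(_ _ r2).
by case: (z).
Unshelve. all: by end_near. Qed.

(* The completeness instance of the library is keyed on [R^o] for real [R],
   hence an alias to carry the one of the complex plane. *)
Definition cplane (R : realType) : Type := R[i]^o.
HB.instance Definition _ (R : realType) :=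
  NormedModule.copy (cplane R) R[i]^o.
HB.instance Definition _ (R : realType) :=
  Uniform_isComplete.Build (cplane R) (@complex_complete R).

(* C*-algebras are not assumed unital. *)
Record cstarAlg (R : realType) := CstarAlg {
  cs_car :> completeNormedModType R[i];
  cmul : cs_car -> cs_car -> cs_car;
  cstar : cs_car -> cs_car;
  cmulA : forall a b c, cmul a (cmul b c) = cmul (cmul a b) c;
  cmulDl : forall a b c, cmul (a + b) c = cmul a c + cmul b c;
  cmulDr : forall a b c, cmul a (b + c) = cmul a b + cmul a c;
  cmulZl : forall (z : R[i]) a b, cmul (z *: a) b = z *: cmul a b;
  cmulZr : forall (z : R[i]) a b, cmul a (z *: b) = z *: cmul a b;
  cstarK : involutive cstar;
  cstarD : forall a b, cstar (a + b) = cstar a + cstar b;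
  cstarZ : forall (z : R[i]) a, cstar (z *: a) = z^* *: cstar a;
  cstarM : forall a b, cstar (cmul a b) = cmul (cstar b) (cstar a);
  cnormM : forall a b, `|cmul a b| <= `|a| * `|b|;
  cnorm_cstar : forall a, `|cmul (cstar a) a| = `|a| ^+ 2
}.

Definition cpositive (R : realType) (A : cstarAlg R) (a : A) : Prop :=
  exists b : A, a = cmul (cstar b) b.

Definition complex_cstar (R : realType) : cstarAlg R.
Proof.
refine (@CstarAlg R (cplane R) (fun x y => (x : R[i]) * y)
  (fun x => (x : R[i])^*) _ _ _ _ _ _ _ _ _ _ _).
- exact: mulrA.
- exact: mulrDl.
- exact: mulrDr.
- by move=> z a b; rewrite -[RHS]/(z * (_ * _)) mulrA.
- by move=> z a b; rewrite -[RHS]/(z * (_ * _)) mulrCA.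
- exact: conjCK.
- exact: rmorphD.
- exact: rmorphM.
- by move=> a b; rewrite rmorphM mulrC.
- by move=> a b; rewrite -[leLHS]/(`|(a : R[i]) * b|) normrM.
- move=> a; rewrite -[LHS]/(`|(a : R[i])^* * a|) normrM.
  by rewrite norm_conjC -expr2.
Defined.

(* Inner products are linear in the second variable; their definiteness and
   the completeness of the module are carried by [ip_norm] and the carrier. *)
Record hmodule (R : realType) (A : cstarAlg R) := HModule {
  hm_car :> completeNormedModType R[i];
  ract : hm_car -> A -> hm_car;
  ip : hm_car -> hm_car -> A;
  ractA : forall x a b, ract (ract x a) b = ract x (cmul a b);
  ractDl : forall x y a, ract (x + y) a = ract x a + ract y a;
  ractDr : forall x a b, ract x (a + b) = ract x a + ract x b;
  ractZl : forall (z : R[i]) x a, ract (z *: x) a = z *: ract x a;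
  ractZr : forall (z : R[i]) x a, ract x (z *: a) = z *: ract x a;
  ipDr : forall x y y', ip x (y + y') = ip x y + ip x y';
  ipZr : forall (z : R[i]) x y, ip x (z *: y) = z *: ip x y;
  ip_ract : forall x y a, ip x (ract y a) = cmul (ip x y) a;
  ip_cstar : forall x y, cstar (ip x y) = ip y x;
  ip_positive : forall x, cpositive (ip x x);
  ip_norm : forall x, `|x| ^+ 2 = `|ip x x|
}.

Definition self_hmodule (R : realType) (A : cstarAlg R) : hmodule A.
Proof.
refine (@HModule R A A (@cmul R A) (fun a b => cmul (cstar a) b)
  _ _ _ _ _ _ _ _ _ _ _).
- by move=> *; rewrite cmulA.
- exact: cmulDl.
- by move=> *; rewrite cmulDr.
- exact: cmulZl.
- by move=> *; rewrite cmulZr.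
- by move=> *; rewrite cmulDr.
- by move=> *; rewrite cmulZr.
- by move=> *; rewrite cmulA.
- by move=> *; rewrite cstarM cstarK.
- by move=> x; exists x.
- by move=> *; rewrite cnorm_cstar.
Defined.

(* Over the complex numbers the right action is forced to be scalar
   multiplication, so these are exactly the complex Hilbert spaces. *)
Definition hilbert (R : realType) := hmodule (complex_cstar R).

Definition lspan (R : realType) (V : completeNormedModType R[i])
    (S : set V) : set V :=
  [set x | exists n (c : 'I_n -> R[i]) (s : 'I_n -> V),
     (forall i, S (s i)) /\ x = \sum_i c i *: s i].

Definition bounded_op (R : realType) (V W : completeNormedModType R[i])
    (f : V -> W) : Prop := linear f /\ continuous f.

Definition contraction (R : realType) (V W : completeNormedModType R[i])
    (f : V -> W) : Prop := linear f /\ forall x, `|f x| <= `|x|.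

Definition is_adjoint (R : realType) (A : cstarAlg R) (E F : hmodule A)
    (f : E -> F) (g : F -> E) : Prop :=
  forall x y, ip (f x) y = ip x (g y).

(* The adjoint is unique when it exists; the default value 0 is never reached
   for bounded operators between Hilbert spaces. *)
Definition adj (R : realType) (A : cstarAlg R) (E F : hmodule A)
    (f : E -> F) : F -> E :=
  xget (fun=> 0) [set g | is_adjoint f g].

Definition is_isometry (R : realType) (A : cstarAlg R) (E F : hmodule A)
    (f : E -> F) : Prop :=
  linear f /\ forall x y, ip (f x) (f y) = ip x y.

Definition is_unitary (R : realType) (A : cstarAlg R) (E F : hmodule A)
    (f : E -> F) : Prop :=
  is_isometry f /\ forall y, exists x, f x = y.

Definition is_coisometry (R : realType) (A : cstarAlg R) (E F : hmodule A)
    (f : E -> F) : Prop :=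
  forall y, f (adj f y) = y.

(* Nondegenerate *-homomorphisms from [A] to the bounded adjointable
   operators of a Hilbert [B]-module: the left actions of C*-correspondences
   and, when [B] is the complex field, the nondegenerate representations of [A]
   on a Hilbert space. *)
Record left_action (R : realType) (A B : cstarAlg R) (E : hmodule B) :=
  LeftAction {
  lact :> A -> E -> E;
  lact_bounded : forall a, bounded_op (lact a);
  lactD : forall a b x, lact (a + b) x = lact a x + lact b x;
  lactZ : forall (z : R[i]) a x, lact (z *: a) x = z *: lact a x;
  lactM : forall a b x, lact (cmul a b) x = lact a (lact b x);
  lact_adjoint : forall a, is_adjoint (lact a) (lact (cstar a));
  lact_nondegenerate :
    closure (lspan [set y | exists a x, y = lact a x]) = setT
}.

Record corr (R : realType) (A B : cstarAlg R) := Corr {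
  corr_mod :> hmodule B;
  corr_act : left_action A corr_mod
}.
Arguments Corr {R A B corr_mod} _.

Record tensor (R : realType) (A B D : cstarAlg R)
    (E : corr A B) (F : corr B D) := Tensor {
  tens_corr : corr A D;
  tens : E -> F -> tens_corr;
  tens_linearl : forall h, linear (fun x => tens x h);
  tens_linearr : forall x, linear (tens x);
  tens_balanced : forall x b h,
    tens (ract x b) h = tens x (corr_act F b h);
  tens_ract : forall x h d, ract (tens x h) d = tens x (ract h d);
  tens_lact : forall a x h,
    corr_act tens_corr a (tens x h) = tens (corr_act E a x) h;
  tens_ip : forall x y h k,
    ip (tens x h) (tens y k) = ip h (corr_act F (ip x y) k);
  tens_dense : closure (lspan [set u | exists x h, u = tens x h]) = setT
}.

(* The interior tensor product of any pair exists (completion of the algebraic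
   balanced tensor product) and is unique up to a canonical unitary; an element
   of this type fixes one for every pair, so as to speak of "the" tensor
   product. *)
Definition tensor_product (R : realType) :=
  forall (A B D : cstarAlg R) (E : corr A B) (F : corr B D), tensor E F.

Definition tprod (R : realType) (ot : tensor_product R) (A B D : cstarAlg R)
    (E : corr A B) (F : corr B D) : corr A D := tens_corr (ot A B D E F).
Arguments tprod {R} ot {A B D} E F.

Definition telt (R : realType) (ot : tensor_product R) (A B D : cstarAlg R)
    (E : corr A B) (F : corr B D) (x : E) (h : F) : tprod ot E F :=
  tens (ot A B D E F) x h.

(* The operators below are the unique bounded ones with the given values on
   elementary tensors (0 if there is none). *)

Definition tmap (R : realType) (ot : tensor_product R) (A B D : cstarAlg R)
    (E E' : corr A B) (F F' : corr B D) (f : E -> E') (g : F -> F') :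
    tprod ot E F -> tprod ot E' F' :=
  xget (fun=> 0) [set W | bounded_op W /\
    forall x h, W (telt ot x h) = telt ot (f x) (g h)].
Arguments tmap {R} ot {A B D} E E' F F' f g _.

Definition assoc (R : realType) (ot : tensor_product R)
    (A B C D : cstarAlg R) (E : corr A B) (F : corr B C) (G : corr C D) :
    tprod ot (tprod ot E F) G -> tprod ot E (tprod ot F G) :=
  xget (fun=> 0) [set W | bounded_op W /\
    forall x y h, W (telt ot (telt ot x y) h) = telt ot x (telt ot y h)].
Arguments assoc {R} ot {A B C D} E F G _.

Definition assoc_inv (R : realType) (ot : tensor_product R)
    (A B C D : cstarAlg R) (E : corr A B) (F : corr B C) (G : corr C D) :
    tprod ot E (tprod ot F G) -> tprod ot (tprod ot E F) G :=
  xget (fun=> 0) [set W | bounded_op W /\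
    forall x y h, W (telt ot x (telt ot y h)) = telt ot (telt ot x y) h].
Arguments assoc_inv {R} ot {A B C D} E F G _.

Definition tid (R : realType) (ot : tensor_product R) (A B D : cstarAlg R)
    (E : corr A B) (F F' : corr B D) (g : F -> F') :
    tprod ot E F -> tprod ot E F' := tmap ot E E F F' id g.
Arguments tid {R} ot {A B D} E F F' g _.

(* The hexagon is the coherence condition on E_i (x) E_j (x) E_l, with the
   associators written out. *)
Record product_system (R : realType) (ot : tensor_product R)
    (A : cstarAlg R) (k : nat) := ProductSystem {
  ps_corr :> 'I_k -> corr A A;
  ps_t : forall i j : 'I_k,
    tprod ot (ps_corr i) (ps_corr j) -> tprod ot (ps_corr j) (ps_corr i);
  ps_t_unitary : forall i j, is_unitary (@ps_t i j);
  ps_t_lact : forall i j a x,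
    ps_t (corr_act (tprod ot (ps_corr i) (ps_corr j)) a x) =
    corr_act (tprod ot (ps_corr j) (ps_corr i)) a (@ps_t i j x);
  ps_t_ract : forall i j x a, ps_t (ract x a) = ract (@ps_t i j x) a;
  ps_t_inv : forall i j, cancel (@ps_t i j) (@ps_t j i);
  ps_t_id : forall i x, @ps_t i i x = x;
  ps_t_hexagon : forall i j l, i != j -> j != l -> i != l ->
    let E := ps_corr in let t := ps_t in
    let EE i j := tprod ot (E i) (E j) in
    let alpha i j l := assoc ot (E i) (E j) (E l) in
    let alpha' i j l := assoc_inv ot (E i) (E j) (E l) in
    let tI i j l := tmap ot (EE i j) (EE j i) (E l) (E l) (@t i j) id in
    let It l i j := tid ot (E l) (EE i j) (EE j i) (@t i j) in
    It l i j \o alpha l i j \o tI i l j \o alpha' i l j \o It i j l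
      \o alpha i j l =
    alpha l j i \o tI j l i \o alpha' j l i \o It j i l \o alpha j i l
      \o tI i j l
}.
Arguments ps_t {R ot A k} _ i j _.

(* ||v||^2 for v in the direct sum E^n *)
Definition sqnorm (R : realType) (A : cstarAlg R) (E : hmodule A) (n : nat)
    (v : 'I_n -> E) : R[i] := `|\sum_p ip (v p) (v p)|.

(* The norm of a matrix X over a Hilbert A-module E is its norm as an operator
   A^n -> E^n, (v_q) |-> (sum_q X_pq v_q), since X^*X is the A-valued Gram
   matrix of X; the norm of a matrix over B(H) is its norm as an operator
   H^n -> H^n. *)
Definition completely_contractive (R : realType) (A : cstarAlg R)
    (E : hmodule A) (H : hilbert R) (T : E -> H -> H) : Prop :=
  forall (n : nat) (X : 'M[E]_n) (c : R[i]), 0 <= c ->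
    (forall v : 'I_n -> self_hmodule A,
       sqnorm (fun p => \sum_q ract (X p q) (v q)) <= c ^+ 2 * sqnorm v) ->
    forall h : 'I_n -> H,
      sqnorm (fun p => \sum_q T (X p q) (h q)) <= c ^+ 2 * sqnorm h.

Definition tilde (R : realType) (ot : tensor_product R) (A : cstarAlg R)
    (E : corr A A) (H : hilbert R) (sigma : left_action A H)
    (T : E -> H -> H) : tprod ot E (Corr sigma) -> H :=
  xget (fun=> 0) [set W | bounded_op W /\
    forall (x : E) (h : Corr sigma), W (telt ot x h) = T x h].
Arguments tilde {R} ot {A E H} sigma T _.

(* [ic_tilde] says that T x h extends to a bounded operator on the tensor
   product, i.e. that [tilde] is not the default value. *)
Record isometric_covariant (R : realType) (ot : tensor_product R)
    (A : cstarAlg R) (E : corr A A) (H : hilbert R)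
    (sigma : left_action A H) (T : E -> H -> H) : Prop := {
  ic_bounded : forall x, bounded_op (T x);
  ic_linear : forall h, linear (fun x => T x h);
  ic_cc : completely_contractive T;
  ic_covariant : forall a x b h,
    T (ract (corr_act E a x) b) h = sigma a (T x (sigma b h));
  ic_tilde : forall (x : E) (h : Corr sigma),
    tilde ot sigma T (telt ot x h) = T x h;
  ic_isometry : is_isometry (tilde ot sigma T)
}.

Section Representation.
Context (R : realType) (ot : tensor_product R) (A : cstarAlg R) (k : nat)
  (E : product_system ot A k) (H : hilbert R) (sigma : left_action A H)
  (T : forall i, E i -> H -> H) (U : 'I_k -> 'I_k -> H -> H).

Let Hs : corr A (complex_cstar R) := Corr sigma.
Let EH (i : 'I_k) : corr A (complex_cstar R) := tprod ot (E i) Hs.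
Let tT (i : 'I_k) : EH i -> Hs := tilde ot sigma (@T i).

Definition twist (i j : 'I_k) :
    tprod ot (tprod ot (E i) (E j)) Hs -> tprod ot (tprod ot (E j) (E i)) Hs :=
  tmap ot (tprod ot (E i) (E j)) (tprod ot (E j) (E i)) Hs Hs
    (ps_t E i j) (U i j).

Record twisted_representation : Prop := {
  tw_isometric : forall i, isometric_covariant ot sigma (@T i);
  tw_unitary : forall i j, i != j -> is_unitary (U i j);
  tw_adjoint : forall i j, i != j -> is_adjoint (U i j) (U j i);
  tw_tilde : forall i j l, i != j ->
    U i j \o @tT l = @tT l \o tid ot (E l) Hs Hs (U i j);
  tw_sigma : forall i j a, i != j -> U i j \o sigma a = sigma a \o U i j;
  tw_comm : forall i j, i != j ->
    @tT i \o tid ot (E i) (EH j) Hs (@tT j) \o assoc ot (E i) (E j) Hs =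
    @tT j \o tid ot (E j) (EH i) Hs (@tT i) \o assoc ot (E j) (E i) Hs
      \o @twist i j
}.

Definition doubly_twisted : Prop :=
  twisted_representation /\
  forall i j, i != j ->
    adj (@tT j) \o @tT i =
    tid ot (E j) (EH i) Hs (@tT i) \o assoc ot (E j) (E i) Hs
      \o @twist i j
      \o assoc_inv ot (E i) (E j) Hs \o tid ot (E i) Hs (EH j) (adj (@tT j)).

Definition fully_coisometric : Prop := forall j, is_coisometry (@tT j).

End Representation.

Record directed_set (I : Type) (le : I -> I -> Prop) : Prop := {
  dir_inhabited : inhabited I;
  dir_refl : forall m, le m m;
  dir_trans : forall m n l, le m n -> le n l -> le m l;
  dir_bound : forall m n, exists l, le m l /\ le n l
}.

(* [ds_phi n m] is only meaningful when [le m n]. *)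
Record direct_system (R : realType) (I : Type) (le : I -> I -> Prop) :=
  DirectSystem {
  ds_space :> I -> hilbert R;
  ds_phi : forall n m : I, ds_space m -> ds_space n;
  ds_isometry : forall m n, le m n -> is_isometry (@ds_phi n m);
  ds_comp : forall m n l, le m n -> le n l ->
    @ds_phi l n \o @ds_phi n m = @ds_phi l m;
  ds_id : forall m, @ds_phi m m = id
}.
Arguments ds_phi {R I le} _ n m _.

Record is_direct_limit (R : realType) (I : Type) (le : I -> I -> Prop)
    (D : direct_system R le) (L : hilbert R) (psi : forall m, D m -> L) :
    Prop := {
  dl_isometry : forall m, is_isometry (@psi m);
  dl_compat : forall m n, le m n -> @psi n \o ds_phi D n m = @psi m;
  dl_universal : forall (K : hilbert R) (f : forall m, D m -> K),
    (forall m, contraction (@f m)) ->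
    (forall m n, le m n -> @f n \o ds_phi D n m = @f m) ->
    exists! F : L -> K, contraction F /\ forall m, F \o @psi m = @f m;
  dl_dense : closure [set x | exists m h, x = @psi m h] = setT
}.

(* Main.v *)
(** A compatible family of uniformly bounded operators on the spaces H_m extends
    to H_oo by the universal property, and identities between bounded operators
    on H_oo need only be checked on the dense union of the ranges of the psi_m.
    The bound on sigma_m(a) that is uniform in m comes from the fact that a
    representation of a C*-algebra is automatically bounded: if b is small and
    self-adjoint then 1 - b = (1 - d)^2 with d self-adjoint, so that
    <h, sigma(b) h> <= |h|^2.  Operators on an interior tensor product with
    values in a Hilbert space exist, as isometries, as soon as they preserve the
    inner products of elementary tensors.

    Under either condition of (2), the range of the isometry T~_{oo,j} contains
    every psi_m(H_m); being closed, it is everything, and T~_{oo,j} is unitary.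
    The doubly twisted relation is then the twisted one multiplied on the left
    by T~_j^* and on the right by I (x) T~_j^*. *)

Require Import Defs.
From HB Require Import structures.
From mathcomp Require Import all_boot all_order all_algebra.
From mathcomp Require Import boolp classical_sets functions reals topology.
From mathcomp Require Import normedtype sequences complex.
From mathcomp Require Import ring.

Set Implicit Arguments.
Unset Strict Implicit.
Unset Printing Implicit Defensive.

Import Order.TTheory GRing.Theory Num.Theory.
Import numFieldNormedType.Exports.

Local Open Scope classical_set_scope.
Local Open Scope ring_scope.

(** * Bounded operators and density *)

Section BoundedOperators.
Context (R : realType) (V W : completeNormedModType R[i]).
Implicit Types f g : V -> W.

(** Packs a bare linear function into the bundled structure, to which the general lemmas on linear
    maps apply. *)
Definition linear_of f (fl : linear f) : {linear V -> W} :=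
  HB.pack_for {linear V -> W} f (GRing.isLinear.Build R[i] V W *:%R f fl).

Lemma lin0 f : linear f -> f 0 = 0.
Proof. by move=> fl; apply: (raddf0 (linear_of fl)). Qed.
Lemma linD f : linear f -> {morph f : x y / x + y}.
Proof. by move=> fl; apply: (raddfD (linear_of fl)). Qed.
Lemma linB f : linear f -> {morph f : x y / x - y}.
Proof. by move=> fl; apply: (raddfB (linear_of fl)). Qed.
Lemma linZ f : linear f -> forall c, {morph f : x / c *: x}.
Proof. by move=> fl c; apply: (linearZ_LR (linear_of fl)). Qed.
Lemma lin_sum f : linear f -> forall n (c : 'I_n -> R[i]) (v : 'I_n -> V),
  f (\sum_i c i *: v i) = \sum_i c i *: f (v i).
Proof.
move=> fl n c v; rewrite -[LHS]/(linear_of fl _) raddf_sum.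
by apply: eq_bigr => i _; exact: linZ.
Qed.

Lemma lipschitz_bounded_op f (C : R[i]) :
  linear f -> (forall x, `|f x| <= C * `|x|) -> bounded_op f.
Proof.
move=> fl fC; split=> // x; apply/cvgrPdist_lt => e e0.
(* No sign is assumed of [C]; [|C| + 1] is a positive constant for which the same estimate holds. *)
have C1 : 0 < `|C| + 1 by rewrite ltr_wpDl.
near=> y; rewrite -linB //.
apply: le_lt_trans (_ : (`|C| + 1) * `|x - y| < _).
  have := fC (x - y) => /[dup] /le_trans tr le1.
  have C0 : C * `|x - y| \is Num.real.
    by rewrite ger0_real // (le_trans _ le1).
  apply: tr; rewrite (le_trans (real_ler_norm C0)) // normrM normr_id.
  by rewrite ler_wpM2r // lerDl.
rewrite -ltr_pdivlMl //; near: y; apply: cvgr_dist_lt => //.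
by rewrite mulr_gt0 // invr_gt0.
Unshelve. all: by end_near. Qed.

(** The points where [f] and [g] agree form a closed set, which contains the span of [S] by
    linearity. *)
Lemma bounded_op_eq_in f g (x : V) (S : set V) :
  bounded_op f -> bounded_op g -> (forall y, S y -> f y = g y) ->
  closure (lspan S) x -> f x = g x.
Proof.
move=> [fl fc] [gl gc] fg; set Z := [set x | f x - g x = 0].
have cZ : closed Z.
  apply: (@preimage_closed _ _ (fun x => f x - g x) [set 0]).
    move=> y _; apply: cvgB; [exact: fc|exact: gc].
  exact: accessible_closed_set1 (hausdorff_accessible (@norm_hausdorff _ _)) _.
move=> Sx; suff : Z x by rewrite /Z /= => /eqP; rewrite subr_eq0 => /eqP.
rewrite (closure_id Z).1 //; move: Sx; apply: closure_subset.
move=> _ [n [c [s [Ss ->]]]]; rewrite /Z /= !lin_sum // -sumrB big1 // => i _.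
by rewrite fg // subrr.
Qed.

Lemma bounded_op_eq f g (S : set V) :
  bounded_op f -> bounded_op g -> closure (lspan S) = setT ->
  (forall y, S y -> f y = g y) -> f = g.
Proof.
move=> fb gb ST fg; apply/funext => x.
by apply: (bounded_op_eq_in fb gb fg); rewrite ST.
Qed.

End BoundedOperators.

Lemma bounded_op_id (R : realType) (V : completeNormedModType R[i]) :
  bounded_op (@id V).
Proof. by split=> // x; exact: cvg_id. Qed.

Lemma bounded_op_comp (R : realType) (V W X : completeNormedModType R[i])
    (f : V -> W) (g : W -> X) :
  bounded_op f -> bounded_op g -> bounded_op (g \o f).
Proof.
move=> [fl fc] [gl gc]; split; first by move=> c x y /=; rewrite fl gl.
by move=> x; apply: continuous_comp; [exact: fc|exact: gc].
Qed.

Lemma bounded_opD (R : realType) (V W : completeNormedModType R[i])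
    (f g : V -> W) :
  bounded_op f -> bounded_op g -> bounded_op (fun x => f x + g x).
Proof.
move=> [fl fc] [gl gc]; split=> [c x y|x].
  by rewrite fl gl scalerDr addrACA.
by apply: cvgD; [exact: fc|exact: gc].
Qed.

Lemma bounded_opZ (R : realType) (V W : completeNormedModType R[i]) (c : R[i])
    (f : V -> W) : bounded_op f -> bounded_op (fun x => c *: f x).
Proof.
move=> [fl fc]; split=> [a x y|x].
  by rewrite fl scalerDr !scalerA mulrC.
by apply: cvgZ; [exact: cvg_cst|exact: fc].
Qed.

(** * Hilbert spaces *)

Section Hilbert.
Context (R : realType) (H : hilbert R).
Implicit Types x y z : H.

(** The values of [ip] lie in the carrier of [complex_cstar]; typing them in [R[i]] gives access to
    its field structure, conjugation and order. *)
Definition hip x y : R[i] := ip x y.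

Lemma hipE x y : ip x y = hip x y. Proof. by []. Qed.
Lemma hipDr x y z : hip x (y + z) = hip x y + hip x z.
Proof. exact: (ipDr x y z). Qed.
Lemma hipZr (c : R[i]) x y : hip x (c *: y) = c * hip x y.
Proof. exact: (ipZr c x y). Qed.
Lemma hipC x y : (hip x y)^* = hip y x.
Proof. exact: (ip_cstar x y). Qed.
Lemma hipDl x y z : hip (y + z) x = hip y x + hip z x.
Proof. by rewrite -hipC hipDr rmorphD /= !hipC. Qed.
Lemma hipZl (c : R[i]) x y : hip (c *: y) x = c^* * hip y x.
Proof. by rewrite -hipC hipZr rmorphM /= hipC. Qed.
Lemma hipNr x y : hip x (- y) = - hip x y.
Proof. by rewrite -scaleN1r hipZr mulN1r. Qed.
Lemma hipNl x y : hip (- y) x = - hip y x.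
Proof. by rewrite -hipC hipNr rmorphN /= hipC. Qed.
Lemma hipBr x y z : hip x (y - z) = hip x y - hip x z.
Proof. by rewrite hipDr hipNr. Qed.
Lemma hipBl x y z : hip (y - z) x = hip y x - hip z x.
Proof. by rewrite hipDl hipNl. Qed.

(** By positivity [ip x x] is a conjugate times the number itself, hence nonnegative and equal to
    its own norm. *)
Lemma hip_norm x : hip x x = `|x| ^+ 2.
Proof.
rewrite ip_norm; have [b eb] := ip_positive x; rewrite eb.
rewrite /hip eb -[LHS]/((b : R[i])^* * b) -[RHS]/(`|(b : R[i])^* * b|).
by rewrite mulrC -normCK normrX normr_id.
Qed.

Lemma cauchy_schwarz x y : `|hip x y| <= `|x| * `|y|.
Proof.
have [->|y0] := eqVneq y 0.
  by rewrite -(scale0r (0 : H)) hipZr mul0r normr0 mulr_ge0.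
have ny : `|y| ^+ 2 != 0 by rewrite expf_eq0 /= normr_eq0.
rewrite -(@ler_pXn2r _ 2) // ?nnegrE ?mulr_ge0 // exprMn normCK hipC.
(* [c *: y] is the orthogonal projection of [x] on the line of [y]; the inequality says that the
   squared distance to it is nonnegative. *)
pose c := hip y x / `|y| ^+ 2.
have : 0 <= `|x - c *: y| ^+ 2 by rewrite exprn_ge0.
rewrite -hip_norm hipBl !hipBr !hipZl !hipZr !hip_norm /c.
rewrite rmorphM /= hipC fmorphV rmorphXn /= (conj_Creal (normr_real y)).
set a := `|x| ^+ 2; set b := `|y| ^+ 2; set s := hip x y; set t := hip y x.
rewrite (_ : _ - _ = a - s * t / b); last by field.
by rewrite subr_ge0 ler_pdivrMr // lt_neqAle eq_sym ny exprn_ge0.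
Qed.

Lemma hip_inj y z : (forall x, hip x y = hip x z) -> y = z.
Proof.
move=> yz; have : `|y - z| ^+ 2 = 0 by rewrite -hip_norm hipBr yz subrr.
by move/eqP; rewrite expf_eq0 /= normr_eq0 subr_eq0 => /eqP.
Qed.

Lemma hip_bounded x : bounded_op (fun y => hip x y : cplane R).
Proof.
apply: (@lipschitz_bounded_op _ _ _ _ `|x|); last exact: cauchy_schwarz.
by move=> c y z; rewrite hipDr hipZr.
Qed.

End Hilbert.

Section HilbertMaps.
Context (R : realType) (H K : hilbert R).
Implicit Types (f : H -> K) (x y : H).

Lemma isometry_norm f : is_isometry f -> forall x, `|f x| = `|x|.
Proof.
move=> [_ fi] x; apply/eqP; rewrite -(@eqrXn2 _ 2) //.
by rewrite -!hip_norm /hip fi.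
Qed.

Lemma isometry_bounded f : is_isometry f -> bounded_op f.
Proof.
move=> fi; apply: (@lipschitz_bounded_op _ _ _ _ 1); first exact: fi.1.
by move=> x; rewrite isometry_norm // mul1r.
Qed.

(* The sesquilinear form is recovered from the quadratic one by polarization. *)
Lemma norm_preserving_isometry f :
  linear f -> (forall x, `|f x| = `|x|) -> is_isometry f.
Proof.
move=> fl fn; split=> // x y; rewrite !hipE.
have sq u : hip (f u) (f u) = hip u u by rewrite !hip_norm fn.
have re : hip (f x) (f y) + hip (f y) (f x) = hip x y + hip y x.
  have := sq (x + y); rewrite linD // !hipDl !hipDr !sq => e.
  by apply: (addrI (hip x x)); apply: (addIr (hip y y)); rewrite !addrA in e *.
have im : hip (f x) (f y) - hip (f y) (f x) = hip x y - hip y x.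
  have := sq (x + 'i *: y); rewrite linD // linZ // !hipDl !hipDr !hipZl !hipZr !sq.
  rewrite conjCi => e; apply: (mulfI (@neq0Ci R[i])).
  apply: (addrI (hip x x)); apply: (addIr (- 'i * ('i * hip y y))).
  by rewrite !mulrBr -!mulNr !addrA in e *.
have two : (2 : R[i]) != 0 by rewrite pnatr_eq0.
apply: (mulfI two).
transitivity ((hip (f x) (f y) + hip (f y) (f x))
  + (hip (f x) (f y) - hip (f y) (f x))); first by ring.
by rewrite re im; ring.
Qed.

End HilbertMaps.

(** * Approximation and closures of linear spans *)

Lemma closure_normP (R : realType) (V : normedModType R[i]) (S : set V) x :
  closure S x <-> forall e : R[i], 0 < e -> exists2 y, S y & `|x - y| < e.
Proof.
split=> [Sx e e0|Sx B].
  by have [y [Sy xy]] := Sx _ (nbhsx_ballx x e e0); exists y => //; rewrite -ball_normE in xy.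
move=> /nbhs_ballP[e e0 eB]; have [y Sy xy] := Sx e e0.
by exists y; split=> //; apply: eB; rewrite -ball_normE.
Qed.

Lemma normr_small_eq0 (R : realType) (V : normedModType R[i]) (x : V) :
  (forall e : R[i], 0 < e -> `|x| < e) -> x = 0.
Proof.
move=> xe; apply/eqP; apply/negP => /negP; rewrite -normr_gt0 => /xe.
by rewrite ltxx.
Qed.

Lemma norm_comb_lt (R : realType) (V : normedModType R[i]) (c e : R[i])
    (x y u v : V) : `|x - u| < e / (`|c| + 1) -> `|y - v| < e / (`|c| + 1) ->
  `|(c *: x + y) - (c *: u + v)| < e.
Proof.
move=> xu yv; rewrite opprD addrACA -scalerBr.
have c1 : 0 < `|c| + 1 by rewrite ltr_wpDl.
apply: le_lt_trans (ler_normD _ _) _; rewrite normrZ.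
rewrite [ltRHS](_ : _ = `|c| * (e / (`|c| + 1)) + e / (`|c| + 1)); last first.
  by field; rewrite gt_eqF.
by rewrite ler_ltD // ler_wpM2l // ltW.
Qed.

Lemma norm_comb_gt0 (R : realType) (c e : R[i]) : 0 < e -> 0 < e / (`|c| + 1).
Proof. by move=> e0; rewrite divr_gt0 // ltr_wpDl. Qed.

Section Span.
Context (R : realType) (V : completeNormedModType R[i]).
Implicit Types S : set V.

Lemma lspan_gen S x : S x -> lspan S x.
Proof.
move=> Sx; exists 1%N, (fun=> 1), (fun=> x); split=> //.
by rewrite big_ord1 scale1r.
Qed.

Lemma lspan_comb S c x y : lspan S x -> lspan S y -> lspan S (c *: x + y).
Proof.
move=> [n [a [s [Ss ->]]]] [m [b [t [St ->]]]]; exists (n + m)%N.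
exists (fun i : 'I_(n + m) => match fintype.split i with inl j => c * a j | inr j => b j end).
exists (fun i : 'I_(n + m) => match fintype.split i with inl j => s j | inr j => t j end).
split; first by move=> i; case: fintype.split.
rewrite big_split_ord /= scaler_sumr; congr (_ + _); apply: eq_bigr => i _.
  by rewrite -[lshift _ _]/(unsplit (inl i)) unsplitK scalerA.
by rewrite -[rshift _ _]/(unsplit (inr i)) unsplitK.
Qed.

Lemma closure_lspan_comb S c x y : closure (lspan S) x -> closure (lspan S) y ->
  closure (lspan S) (c *: x + y).
Proof.
move=> /closure_normP Sx /closure_normP Sy; apply/closure_normP => e e0.
have [u Su xu] := Sx _ (norm_comb_gt0 c e0).
have [v Sv yv] := Sy _ (norm_comb_gt0 c e0).
by exists (c *: u + v); [exact: lspan_comb|exact: norm_comb_lt].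
Qed.

(** The closure of a span is a closed subspace, so it contains all limits of combinations of its
    elements. *)
Lemma closure_lspan_sub S (Z : set V) : (forall x, Z x -> closure (lspan S) x) ->
  closure (lspan Z) `<=` closure (lspan S).
Proof.
move=> ZS; rewrite [X in _ `<=` X](closure_id _).1; last exact: closed_closure.
apply: closure_subset => _ [n [c [s [Zs ->]]]].
apply: big_rec => [|i x _ Sx].
  apply: subset_closure; exists 0%N, (fun=> 0), (fun=> 0).
  by split; [case|rewrite big_ord0].
by apply: closure_lspan_comb => //; exact: ZS.
Qed.

Lemma lspan_dense_sub S (Z : set V) : closure (lspan Z) = setT ->
  (forall x, Z x -> closure (lspan S) x) -> closure (lspan S) = setT.
Proof.
move=> ZT ZS; apply/seteqP; split=> // x _.
by apply: (closure_lspan_sub ZS); rewrite ZT.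
Qed.

End Span.

Lemma bounded_closure_lspan (R : realType) (V W : completeNormedModType R[i])
    (f : V -> W) (S : set V) x : bounded_op f -> closure (lspan S) x ->
  closure (lspan (f @` S)) (f x).
Proof.
move=> [fl fc] Sx B /fc fB; have [y [Sy By]] := Sx _ fB; exists (f y); split=> //.
case: Sy By => n [c [s [Ss ->]]] _; exists n, c, (f \o s); split.
  by move=> i; exists (s i).
exact: lin_sum.
Qed.

(** * Extension of densely defined isometries *)

Section IsometricExtension.
Context (R : realType) (V W : completeNormedModType R[i]) (G : V -> W -> Prop).
Hypothesis G_comb : forall (c : R[i]) x y x' y',
  G x x' -> G y y' -> G (c *: x + y) (c *: x' + y').
Hypothesis G_norm : forall x x', G x x' -> `|x'| = `|x|.
Hypothesis G_dense : closure [set x | exists x', G x x'] = setT.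

(** The closure of the graph [G], with the error measured in each coordinate. *)
Let Gbar u w := forall e : R[i], 0 < e ->
  exists v v', [/\ G v v', `|u - v| < e & `|w - v'| < e].

Let Gbar_comb c u w y z : Gbar u w -> Gbar y z -> Gbar (c *: u + y) (c *: w + z).
Proof.
move=> uw yz e e0; have [v [v' [Gv uv wv]]] := uw _ (norm_comb_gt0 c e0).
have [x [x' [Gx yx zx]]] := yz _ (norm_comb_gt0 c e0).
exists (c *: v + x), (c *: v' + x').
by split; [exact: G_comb|exact: norm_comb_lt|exact: norm_comb_lt].
Qed.

Let Gbar_norm u w : Gbar u w -> `|w| = `|u|.
Proof.
move=> uw; apply/eqP; rewrite -subr_eq0; apply/eqP.
apply: (@normr_small_eq0 R (R[i]^o)) => e e0.
have e2 : 0 < e / 2 by rewrite divr_gt0.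
have [v [v' [Gv uv wv]]] := uw _ e2.
have -> : `|w| - `|u| = (`|w| - `|v'|) - (`|u| - `|v|) by rewrite (G_norm Gv) opprB addrA subrK.
rewrite (le_lt_trans (ler_normB _ _)) // [e]splitr ltrD //.
  exact: le_lt_trans (ler_dist_dist _ _) wv.
exact: le_lt_trans (ler_dist_dist _ _) uv.
Qed.

(** The difference of two pairs with the same first entry is a pair with first entry 0, and both
    entries have the same norm. *)
Let Gbar_uniq u w z : Gbar u w -> Gbar u z -> w = z.
Proof.
move=> uw uz; have /Gbar_norm := Gbar_comb (-1) uz uw.
rewrite !scaleN1r addNr normr0 => /eqP.
by rewrite normr_eq0 addrC subr_eq0 => /eqP.
Qed.

(** A selection of values of [G] on its domain preserves distances, hence is Cauchy along the trace
    on the domain of the neighbourhoods of [u]; completeness of [W] gives the limit. *)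
Let Gbar_ex u : exists w, Gbar u w.
Proof.
pose dom := [set x | exists x', G x x'].
pose s v := xget 0 [set w | G v w].
have sG v : dom v -> G v (s v) by case=> w Gw; apply: (xgetI _ Gw).
have sB v v' : dom v -> dom v' -> `|s v - s v'| = `|v - v'|.
  move=> dv dv'; have := G_comb (-1) (sG _ dv') (sG _ dv).
  by rewrite !scaleN1r ![- _ + _]addrC => /G_norm.
have PF : ProperFilter (within dom (nbhs u)).
  by apply: within_nbhs_proper; rewrite /dom G_dense.
have : cauchy (s @ within dom (nbhs u)).
  apply/cauchy_ballP => e e0; near_simpl.
  have e2 : 0 < e / 2 by rewrite divr_gt0.
  have nu : within dom (nbhs u) [set v | dom v /\ `|u - v| < e / 2].
    have := nbhsx_ballx u _ e2; rewrite -ball_normE.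
    by apply: filterS => v uv dv; split.
  exists ([set v | dom v /\ `|u - v| < e / 2], [set v | dom v /\ `|u - v| < e / 2]).
    by split.
  move=> [v v'] [[dv uv] [dv' uv']] /=; rewrite -ball_normE /= sB //.
  rewrite (_ : v - v' = (v - u) + (u - v')); last by rewrite addrA subrK.
  by rewrite (le_lt_trans (ler_normD _ _)) // [e]splitr ltrD // distrC.
move=> /cauchy_cvg /cvg_ex[/= w sw]; exists w => e e0.
have /cvgrPdist_lt/(_ e e0) := sw; near_simpl => nw.
have : within dom (nbhs u) [set v | [/\ dom v, `|u - v| < e & `|w - s v| < e]].
  have := nbhsx_ballx u _ e0; rewrite -ball_normE => nu.
  by apply: filterS2 nu nw => v uv wv dv; split=> //; exact: wv.
case/filter_ex => v [dv uv wv]; exists v, (s v); split=> //; exact: sG.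
Qed.

(** [G] is a relation, so that it may be given by formal combinations not known beforehand to have a
    well-defined value; linearity and norm preservation make its closure the graph of a function. *)
Lemma isometric_graph_extension : exists F : V -> W,
  [/\ linear F, forall x, `|F x| = `|x| & forall x x', G x x' -> F x = x'].
Proof.
have /choice[F FG] := Gbar_ex; exists F; split.
- by move=> c x y; apply: Gbar_uniq (FG _) _; exact: Gbar_comb.
- by move=> x; exact: Gbar_norm.
move=> x x' Gx; apply: Gbar_uniq (FG x) _ => e e0.
by exists x, x'; rewrite !subrr !normr0.
Qed.

End IsometricExtension.

Section GramExtension.
Context (R : realType) (H K : hilbert R).

Lemma sum_hipl n (c : 'I_n -> R[i]) (x : 'I_n -> H) y :
  hip (\sum_i c i *: x i) y = \sum_i (c i)^* * hip (x i) y.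
Proof.
apply: (big_rec2 (fun u v => hip u y = v)) => [|i u v _ <-].
  by rewrite -(scale0r (0 : H)) hipZl conjC0 mul0r.
by rewrite hipDl hipZl.
Qed.

Lemma sum_hipr n (c : 'I_n -> R[i]) (x : 'I_n -> H) y :
  hip y (\sum_i c i *: x i) = \sum_i c i * hip y (x i).
Proof.
apply: (big_rec2 (fun u v => hip y u = v)) => [|i u v _ <-].
  by rewrite -(scale0r (0 : H)) hipZr mul0r.
by rewrite hipDr hipZr.
Qed.

End GramExtension.

(** Equal Gram matrices make a combination of the [w s] as long as the combination of the [v s] with
    the same coefficients. *)
Lemma gram_extension (R : realType) (H K : hilbert R) (S : Type) (v : S -> H)
    (w : S -> K) : (forall s t, hip (w s) (w t) = hip (v s) (v t)) ->
  closure (lspan [set x | exists s, x = v s]) = setT ->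
  exists F : H -> K, is_isometry F /\ forall s, F (v s) = w s.
Proof.
move=> gram dense.
pose G x y := exists n (c : 'I_n -> R[i]) (s : 'I_n -> S),
  x = \sum_i c i *: v (s i) /\ y = \sum_i c i *: w (s i).
have [c x y x' y'|x x'||F [Fl Fn FG]] := @isometric_graph_extension R H K G.
- move=> [n [a [s [-> ->]]]] [m [b [t [-> ->]]]]; exists (n + m)%N.
  exists (fun i : 'I_(n + m) => match fintype.split i with inl j => c * a j | inr j => b j end).
  exists (fun i : 'I_(n + m) => match fintype.split i with inl j => s j | inr j => t j end).
  split; rewrite big_split_ord /= scaler_sumr; congr (_ + _); apply: eq_bigr => i _.
  + by rewrite -[lshift _ _]/(unsplit (inl i)) unsplitK scalerA.
  + by rewrite -[rshift _ _]/(unsplit (inr i)) unsplitK.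
  + by rewrite -[lshift _ _]/(unsplit (inl i)) unsplitK scalerA.
  + by rewrite -[rshift _ _]/(unsplit (inr i)) unsplitK.
- move=> [n [c [s [-> ->]]]]; apply/eqP; rewrite -(@eqrXn2 _ 2) //; apply/eqP.
  rewrite -!hip_norm !sum_hipl; apply: eq_bigr => i _; congr (_ * _).
  by rewrite !sum_hipr; apply: eq_bigr => j _; rewrite gram.
- apply/seteqP; split=> // x _; have : closure (lspan [set x | exists s, x = v s]) x by rewrite dense.
  apply: closure_subset => _ [n [c [s [vs ->]]]].
  have [t st] := choice vs; exists (\sum_i c i *: w (t i)), n, c, t; split=> //.
  by apply: eq_bigr => i _; rewrite st.
exists F; split; first exact: norm_preserving_isometry.
move=> s; apply: FG; exists 1%N, (fun=> 1), (fun=> s).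
by rewrite !big_ord1 !scale1r.
Qed.

(** * Automatic boundedness of representations *)

Lemma small_half_pow (R : realType) (e : R[i]) : 0 < e ->
  exists n, 2^-1 ^+ n < e.
Proof.
move=> e0; have er : e = (complex.Re e)%:C%C by rewrite RRe_real ?gtr0_real.
have r0 : 0 < complex.Re e by rewrite -ltcR -er.
have h1 : `|2^-1 : R| < 1 by rewrite ger0_norm ?invr_ge0 // invf_lt1 // ltr1n.
have /cvgrPdist_lt/(_ _ r0) := cvg_expr h1.
move=> [n _ /(_ n (leqnn n))] /=; rewrite sub0r normrN ger0_norm ?exprn_ge0 ?invr_ge0 // => nr.
exists n; rewrite er (_ : 2^-1 ^+ n = (2^-1 ^+ n)%:C%C) ?ltcR //.
by rewrite rmorphXn fmorphV rmorph_nat.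
Qed.

Lemma geometric_cvg (R : realType) (V : completeNormedModType R[i])
    (u : nat -> V) : (forall n, `|u n.+1 - u n| <= 2^-1 ^+ n) ->
  cvg (u @ \oo).
Proof.
(* The sum of [2^-i] over [n <= i < n + m] is [2 * (2^-n - 2^-(n + m))]. *)
move=> ule; have dist n m : `|u (n + m)%N - u n| <= 2 * (2^-1 ^+ n - 2^-1 ^+ (n + m)).
  elim: m => [|m IHm]; first by rewrite addn0 !subrr normr0 mulr0.
  rewrite addnS -(subrK (u (n + m)%N) (u (n + m).+1)) -addrA.
  apply: le_trans (ler_normD _ _) _.
  rewrite (_ : 2 * _ = 2^-1 ^+ (n + m) + 2 * (2^-1 ^+ n - 2^-1 ^+ (n + m))).
    by rewrite lerD.
  by rewrite exprS; field.
apply/cauchy_cvgP/cauchy_ballP => e e0; near_simpl.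
have e4 : 0 < e / 4 by rewrite divr_gt0.
(* With [2^-N < e / 4], all later terms are within [2 * (e / 4)] of the [N]-th one. *)
have [N Ne] := small_half_pow e4.
have tail n : (N <= n)%N -> `|u n - u N| < e / 2.
  move=> Nn; rewrite -(subnKC Nn); apply: le_lt_trans (dist _ _) _.
  rewrite (_ : e / 2 = 2 * (e / 4)); last by field.
  by rewrite ltr_pM2l // (le_lt_trans _ Ne) // lerBlDr lerDl exprn_ge0 ?invr_ge0.
exists ([set n | (N <= n)%N], [set n | (N <= n)%N]); first by split; exists N.
move=> [n m] [/= Nn Nm]; rewrite -ball_normE /=.
rewrite (_ : u n - u m = (u n - u N) + (u N - u m)); last by rewrite addrA subrK.
rewrite (le_lt_trans (ler_normD _ _)) // [e]splitr ltrD ?tail //.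
by rewrite distrC tail.
Qed.

Section CstarAlgebra.
Context (R : realType) (A : cstarAlg R).
Implicit Types a b d : A.

(** The square of [|b|] is the norm of [cmul (cstar b) b], at most [|cstar b| * |b|]; this is used
    for an element and for its adjoint. *)
Lemma norm_cstar a : `|cstar a| = `|a|.
Proof.
suff le_norm b : `|b| <= `|cstar b|.
  by apply/eqP; rewrite eq_le -{2}(cstarK a) !le_norm.
have [->|b0] := eqVneq b 0; first by rewrite normr0.
have nb : 0 < `|b| by rewrite normr_gt0.
by rewrite -(ler_pM2r nb) -expr2 -cnorm_cstar cnormM.
Qed.

Lemma cmulBl a b d : cmul (a - b) d = cmul a d - cmul b d.
Proof. by rewrite cmulDl -scaleN1r cmulZl scaleN1r. Qed.

Lemma cmulBr a b d : cmul d (a - b) = cmul d a - cmul d b.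
Proof. by rewrite cmulDr -scaleN1r cmulZr scaleN1r. Qed.

Lemma cstarB a b : cstar (a - b) = cstar a - cstar b.
Proof. by rewrite cstarD -scaleN1r cstarZ rmorphN1 scaleN1r. Qed.

(** The difference of squares is split as [(a - b) a + b (a - b)], which does not use
    commutativity. *)
Lemma csqr_dist a b : `|cmul a a - cmul b b| <= (`|a| + `|b|) * `|a - b|.
Proof.
rewrite (_ : _ - _ = cmul (a - b) a + cmul b (a - b)); last first.
  by rewrite cmulBl cmulBr addrA subrK.
apply: le_trans (ler_normD _ _) _; rewrite mulrDl lerD ?cnormM //.
by rewrite mulrC cnormM.
Qed.

(* In the unitization, [1 - b] is the square of the self-adjoint [1 - d]; [d]
   is the fixed point of a contraction of the ball of radius 1/2. *)
Lemma self_adjoint_sqrt b : cstar b = b -> `|b| <= 2^-1 ->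
  exists2 d, cstar d = d & d + d = b + cmul d d.
Proof.
(* Halving [d + d = b + cmul d d] makes it the fixed point equation of [f], solved by iterating [f]
   from 0. *)
move=> bs bh; pose f d := 2^-1 *: (b + cmul d d).
pose u n := iter n f 0.
have half : `|2^-1 : R[i]| = 2^-1 by rewrite ger0_norm ?invr_ge0.
have h0 : 0 <= 2^-1 :> R[i] by rewrite invr_ge0.
have us n : cstar (u n) = u n.
  elim: n => [|n IHn] /=; first by rewrite -(scale0r (0 : A)) cstarZ rmorph0 !scale0r.
  by rewrite /f cstarZ cstarD bs cstarM IHn fmorphV rmorph_nat.
have un n : `|u n| <= 2^-1.
  elim: n => [|n IHn] /=; first by rewrite normr0.
  rewrite /f normrZ half ler_piMr // (le_trans (ler_normD _ _)) //.
  rewrite [leRHS](_ : 1 = 2^-1 + 2^-1 :> R[i]); last by field.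
  rewrite lerD // (le_trans (cnormM _ _)) // -[leRHS]mulr1 ler_pM //.
  by rewrite (le_trans IHn) // invf_le1 // ler1n.
have fdist a d : f a - f d = 2^-1 *: (cmul a a - cmul d d).
  by rewrite /f -scalerBr opprD addrACA subrr add0r.
(* The iterates stay in the ball of radius 1/2, where the factor in [csqr_dist] is at most 1, so
   each application of [f] at least halves their distances. *)
have step n : `|u n.+1 - u n| <= 2^-1 ^+ n.
  elim: n => [|n IHn].
    by rewrite expr0 /u /= subr0 (le_trans (un 1%N)) // invf_le1 // ler1n.
  rewrite fdist normrZ half exprS ler_wpM2l // (le_trans (csqr_dist _ _)) //.
  rewrite (le_trans _ IHn) // ler_piMl //.
  by apply: le_trans (lerD (un n.+1) (un n)) _; rewrite -[2^-1]mul1r -splitr.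
have /cvg_ex[/= d ud] := geometric_cvg step.
have near_u (e : R[i]) : 0 < e -> exists n, `|d - u n| < e /\ `|d - u n.+1| < e.
  move=> e0; have /cvgrPdist_lt/(_ e e0)[N _ NB] := ud.
  by exists N; split; apply: NB => /=.
exists d.
  apply/eqP; rewrite -subr_eq0; apply/eqP; apply: normr_small_eq0 => e e0.
  have e2 : 0 < e / 2 by rewrite divr_gt0.
  have [n [dn _]] := near_u _ e2.
  rewrite (_ : _ - d = cstar (d - u n) + (u n - d)); last first.
    by rewrite cstarB us addrA subrK.
  rewrite (le_lt_trans (ler_normD _ _)) // [e]splitr ltrD //.
    by rewrite norm_cstar.
  by rewrite distrC.
suff fd : d = f d.
  by rewrite -[RHS]scale1r (_ : 1 = 2^-1 + 2^-1 :> R[i]) ?scalerDl -/(f d) -?fd //; field.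
apply/eqP; rewrite -subr_eq0; apply/eqP; apply: normr_small_eq0 => e e0.
(* [|d| + 2^-1] bounds the factor [|d| + |u n|] of [csqr_dist]; the extra 1 pays for the term
   [d - u n.+1]. *)
have c0 : 0 < `|d| + 2^-1 + 1 by rewrite ltr_wpDl // addr_ge0.
have e2 : 0 < e / (`|d| + 2^-1 + 1) by rewrite divr_gt0.
have [n [dn dn1]] := near_u _ e2.
rewrite (_ : d - _ = (d - u n.+1) + (f (u n) - f d)); last by rewrite addrA subrK.
apply: le_lt_trans (ler_normD _ _) _.
rewrite [ltRHS](_ : _ = e / (`|d| + 2^-1 + 1) + (`|d| + 2^-1) * (e / (`|d| + 2^-1 + 1))); last first.
  move: c0; set q := `|d| + 2^-1 => c0.
  by field; rewrite gt_eqF.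
rewrite ltr_leD // fdist normrZ half distrC.
apply: le_trans (_ : `|cmul d d - cmul (u n) (u n)| <= _).
  by rewrite ler_piMl // invf_le1 // ler1n.
rewrite (le_trans (csqr_dist _ _)) // ler_pM ?addr_ge0 // ?lerD //.
exact: ltW.
Qed.

End CstarAlgebra.

Section Representation.
Context (R : realType) (A : cstarAlg R) (H : hilbert R) (s : left_action A H).
Implicit Types (a b : A) (h : H).

Lemma lactl h : linear (fun a => s a h).
Proof. by move=> c a b; rewrite lactD lactZ. Qed.

Lemma lactr a : linear (s a).
Proof. exact: (lact_bounded s a).1. Qed.

Lemma hip_lact a h k : hip (s a h) k = hip h (s (cstar a) k).
Proof. exact: (lact_adjoint s a h k). Qed.

(** With [b = 2 d - d^2] and [d] self-adjoint, [|h|^2 - <h, b h>] is the squared norm of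
    [h - d h]. *)
Lemma lact_self_adjoint_le b h : cstar b = b -> `|b| <= 2^-1 ->
  hip h (s b h) <= `|h| ^+ 2.
Proof.
move=> bs bh; have [d ds db] := self_adjoint_sqrt bs bh.
have -> : b = d + d - cmul d d by rewrite db addrK.
rewrite -subr_ge0 -hip_norm (linB (lactl h)) (linD (lactl h)) lactM.
rewrite [leRHS](_ : _ = hip (h - s d h) (h - s d h)); last first.
  by rewrite hipBl !hipBr hipDr !hip_lact ds; ring.
by rewrite hip_norm exprn_ge0.
Qed.

(** The factor 2 comes from scaling [a] to norm 1/2, where the square root is available. The bound
    is the same for all representations, as the passage to the limit requires. *)
Lemma norm_lact a h : `|s a h| <= 2 * `|a| * `|h|.
Proof.
(* The squared norm of [s b h] is [<h, s c h>] with [c = cmul (cstar b) b], self-adjoint of norm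
   [|b|^2]. *)
have small b : `|b| <= 2^-1 -> `|s b h| <= `|h|.
  move=> bh; rewrite -(@ler_pXn2r _ 2) // ?nnegrE // -hip_norm hip_lact -lactM.
  apply: lact_self_adjoint_le; first by rewrite cstarM cstarK.
  rewrite cnorm_cstar (le_trans _ bh) // expr2 ler_piMl //.
  by rewrite (le_trans bh) // invf_le1 // ler1n.
have [->|a0] := eqVneq a 0; first by rewrite (lin0 (lactl h)) !normr0 mulr0 mul0r.
have na : 0 < 2 * `|a| by rewrite mulr_gt0 // normr_gt0.
have := small ((2 * `|a|)^-1 *: a).
rewrite lactZ !normrZ normfV (ger0_norm (ltW na)).
have -> : (2 * `|a|)^-1 * `|a| = 2^-1 by field; rewrite normr_eq0.
by move=> /(_ (lexx _)); rewrite ler_pdivrMl.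
Qed.

End Representation.

(** * Operators on interior tensor products *)

Section HilbertTensor.
Context (R : realType) (ot : tensor_product R) (A B : cstarAlg R)
  (E : corr A B) (F : corr B (complex_cstar R)).
Implicit Types (x y : E) (h k : F).

Lemma hip_telt x y h k :
  hip (telt ot x h) (telt ot y k) = hip h (corr_act F (ip x y) k).
Proof. exact: (tens_ip (@ot _ _ _ E F) x y h k). Qed.

Lemma telt_linl h : linear (fun x => telt ot x h).
Proof. exact: (tens_linearl (@ot _ _ _ E F)). Qed.

Lemma telt_linr x : linear (fun h => telt ot x h).
Proof. exact: (tens_linearr (@ot _ _ _ E F)). Qed.

(** The squared norm is [<h, <x, x> h>], at most [2 |x|^2 |h|^2] by [norm_lact], and [2 <= 2^2]. *)
Lemma norm_telt x h : `|telt ot x h| <= 2 * `|x| * `|h|.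
Proof.
rewrite -(@ler_pXn2r _ 2) // ?nnegrE ?mulr_ge0 //.
rewrite -hip_norm hip_telt -[leLHS]ger0_norm ?hip_norm; last first.
  by rewrite -hip_telt hip_norm exprn_ge0.
apply: le_trans (cauchy_schwarz _ _) _.
apply: le_trans (ler_wpM2l (normr_ge0 _) (norm_lact _ _ _)) _.
rewrite -ip_norm; set a := `|x|; set b := `|h|.
have [a0 b0] : 0 <= a /\ 0 <= b by rewrite !normr_ge0.
rewrite (_ : b * (2 * a ^+ 2 * b) = 2 * (a * b) ^+ 2); last by ring.
rewrite -mulrA [leRHS]exprMn ler_wpM2r ?exprn_ge0 ?mulr_ge0 //.
by rewrite expr2 ler_peMr // ler1n.
Qed.

Lemma telt_boundedl h : bounded_op (fun x => telt ot x h).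
Proof.
apply: (@lipschitz_bounded_op _ _ _ _ (2 * `|h|)); first exact: telt_linl.
by move=> x; rewrite mulrAC norm_telt.
Qed.

Lemma telt_boundedr x : bounded_op (fun h => telt ot x h).
Proof.
apply: (@lipschitz_bounded_op _ _ _ _ (2 * `|x|)); first exact: telt_linr.
by move=> h; rewrite norm_telt.
Qed.

Lemma tensor_eq (V : completeNormedModType R[i]) (f g : tprod ot E F -> V) :
  bounded_op f -> bounded_op g ->
  (forall x h, f (telt ot x h) = g (telt ot x h)) -> f = g.
Proof.
move=> fb gb fg; apply: bounded_op_eq fb gb (tens_dense (@ot _ _ _ E F)) _.
by move=> _ [x [h ->]]; exact: fg.
Qed.

Lemma tensor_isometry (K : hilbert R) (g : E -> F -> K) :
  (forall x y h k, hip (g x h) (g y k) = hip h (corr_act F (ip x y) k)) ->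
  exists W : tprod ot E F -> K,
    is_isometry W /\ forall x h, W (telt ot x h) = g x h.
Proof.
move=> gram.
have [||W [Wi Wg]] := @gram_extension R (tprod ot E F) K (E * F)
    (fun p => telt ot p.1 p.2) (fun p => g p.1 p.2).
- by move=> p q; rewrite hip_telt gram.
- rewrite -(tens_dense (@ot _ _ _ E F)); congr (closure (lspan _)).
  by apply/seteqP; split=> [u [p ->]|u [x [h ->]]]; [exists p.1, p.2|exists (x, h)].
by exists W; split=> // x h; exact: (Wg (x, h)).
Qed.

(** Identifies the operator chosen by [xget] in [tilde] and [tmap]: [W] is a candidate, which
    excludes the default 0, and all candidates agree on elementary tensors. *)
Lemma xget_isometry (K : hilbert R) (g : E -> F -> K) (W : tprod ot E F -> K) :
  is_isometry W -> (forall x h, W (telt ot x h) = g x h) ->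
  xget (fun=> 0) [set W | bounded_op W /\
    forall x h, W (telt ot x h) = g x h] = W.
Proof.
move=> Wi Wg; case: xgetP => [V _ [Vb Vg]|/(_ W)[]]; last first.
  by split=> //; exact: isometry_bounded.
by apply: tensor_eq Vb (isometry_bounded Wi) _ => x h; rewrite Vg Wg.
Qed.

End HilbertTensor.

Section TensorMap.
Context (R : realType) (ot : tensor_product R) (A B : cstarAlg R)
  (E E' : corr A B) (F F' : corr B (complex_cstar R)).

(** The intertwining property of [g] turns [<g h, <x, y> g k>] into [<h, <x, y> k>], so inner
    products of elementary tensors are preserved. *)
Lemma tmapP (f : E -> E') (g : F -> F') :
  (forall x y, ip (f x) (f y) = ip x y) -> is_isometry g ->
  (forall b h, g (corr_act F b h) = corr_act F' b (g h)) ->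
  is_isometry (tmap ot E E' F F' f g) /\
  forall x h, tmap ot E E' F F' f g (telt ot x h) = telt ot (f x) (g h).
Proof.
move=> fi gi gb.
have [|W [Wi Wg]] := @tensor_isometry R ot A B E F (tprod ot E' F')
    (fun x h => telt ot (f x) (g h)).
  by move=> x y h k; rewrite hip_telt fi -gb /hip gi.2.
by rewrite /tmap (xget_isometry Wi Wg).
Qed.

End TensorMap.

Lemma tidP (R : realType) (ot : tensor_product R) (A B : cstarAlg R)
    (E : corr A B) (F F' : corr B (complex_cstar R)) (g : F -> F') :
  is_isometry g ->
  (forall b h, g (corr_act F b h) = corr_act F' b (g h)) ->
  is_isometry (tid ot E F F' g) /\
  forall x h, tid ot E F F' g (telt ot x h) = telt ot x (g h).
Proof. by move=> gi gb; exact: (tmapP ot (f := @id E)). Qed.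

(** * Associativity of the interior tensor product *)

Section Associator.
Context (R : realType) (ot : tensor_product R) (A B D : cstarAlg R)
  (E : corr A B) (F : corr B D) (G : corr D (complex_cstar R)).

(** For fixed [h], tensoring with [h] is bounded, so [u] may be approximated by combinations of
    elementary tensors. *)
Lemma tensor3l_dense : closure (lspan [set u | exists x y h,
  u = telt ot (telt ot x y : tprod ot E F) h :> tprod ot _ G]) = setT.
Proof.
apply: lspan_dense_sub (tens_dense (@ot _ _ _ (tprod ot E F) G)) _.
move=> _ [u [h ->]].
have uE : closure (lspan [set u | exists x y, u = telt ot x y :> tprod ot E F]) u.
  by rewrite (tens_dense (@ot _ _ _ E F)).
have := bounded_closure_lspan (telt_boundedl ot (tprod ot E F) h) uE.
apply: closure_lspan_sub => _ [_ [x [y ->]] <-].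
by apply: subset_closure; apply: lspan_gen; exists x, y, h.
Qed.

Lemma tensor3r_dense : closure (lspan [set u | exists x y h,
  u = telt ot x (telt ot y h : tprod ot F G) :> tprod ot E _]) = setT.
Proof.
apply: lspan_dense_sub (tens_dense (@ot _ _ _ E (tprod ot F G))) _.
move=> _ [x [u ->]].
have uE : closure (lspan [set u | exists y h, u = telt ot y h :> tprod ot F G]) u.
  by rewrite (tens_dense (@ot _ _ _ F G)).
have := bounded_closure_lspan (telt_boundedr ot (tprod ot F G) x) uE.
apply: closure_lspan_sub => _ [_ [y [h ->]] <-].
by apply: subset_closure; apply: lspan_gen; exists x, y, h.
Qed.

Lemma tensor3l_eq (V : completeNormedModType R[i])
    (f g : tprod ot (tprod ot E F) G -> V) : bounded_op f -> bounded_op g ->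
  (forall x y h, f (telt ot (telt ot x y) h) = g (telt ot (telt ot x y) h)) ->
  f = g.
Proof.
move=> fb gb fg; apply: bounded_op_eq fb gb tensor3l_dense _.
by move=> _ [x [y [h ->]]]; exact: fg.
Qed.

Lemma tensor3r_eq (V : completeNormedModType R[i])
    (f g : tprod ot E (tprod ot F G) -> V) : bounded_op f -> bounded_op g ->
  (forall x y h, f (telt ot x (telt ot y h)) = g (telt ot x (telt ot y h))) ->
  f = g.
Proof.
move=> fb gb fg; apply: bounded_op_eq fb gb tensor3r_dense _.
by move=> _ [x [y [h ->]]]; exact: fg.
Qed.

(** Both sides reduce to [<h, <y, <x, x'> y'> h'>]. *)
Let gram x y h x' y' h' :
  hip (telt ot x (telt ot y h : tprod ot F G) : tprod ot E _)
      (telt ot x' (telt ot y' h')) =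
  hip (telt ot (telt ot x y : tprod ot E F) h : tprod ot _ G)
      (telt ot (telt ot x' y') h').
Proof.
by rewrite !hip_telt /telt tens_lact -!/(telt _ _ _) hip_telt tens_ip.
Qed.

(** Equality of the Gram matrices for the two bracketings yields an isometry; being the only bounded
    operator with these values, it is the one chosen in [assoc]. *)
Lemma assocP : is_isometry (assoc ot E F G) /\
  forall x y h, assoc ot E F G (telt ot (telt ot x y) h) =
    telt ot x (telt ot y h).
Proof.
suff [W [Wi Wg]] : exists W : tprod ot (tprod ot E F) G -> tprod ot E (tprod ot F G),
    is_isometry W /\ forall x y h,
      W (telt ot (telt ot x y) h) = telt ot x (telt ot y h).
  rewrite /assoc; case: xgetP => [V _ [Vb Vg]|/(_ W)[]]; last first.
    by split=> //; exact: isometry_bounded.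
  have -> // : V = W.
  by apply: tensor3l_eq Vb (isometry_bounded Wi) _ => *; rewrite Vg Wg.
have [||W [Wi Wg]] := @gram_extension R (tprod ot (tprod ot E F) G)
  (tprod ot E (tprod ot F G)) (E * F * G)
  (fun p => telt ot (telt ot p.1.1 p.1.2) p.2)
  (fun p => telt ot p.1.1 (telt ot p.1.2 p.2)).
- by move=> p q; rewrite gram.
- rewrite -tensor3l_dense; congr (closure (lspan _)).
  apply/seteqP; split=> [u [p ->]|u [x [y [h ->]]]].
    by exists p.1.1, p.1.2, p.2.
  by exists (x, y, h).
by exists W; split=> // x y h; exact: (Wg (x, y, h)).
Qed.

Lemma assoc_invP : is_isometry (assoc_inv ot E F G) /\
  forall x y h, assoc_inv ot E F G (telt ot x (telt ot y h)) =
    telt ot (telt ot x y) h.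
Proof.
suff [W [Wi Wg]] : exists W : tprod ot E (tprod ot F G) -> tprod ot (tprod ot E F) G,
    is_isometry W /\ forall x y h,
      W (telt ot x (telt ot y h)) = telt ot (telt ot x y) h.
  rewrite /assoc_inv; case: xgetP => [V _ [Vb Vg]|/(_ W)[]]; last first.
    by split=> //; exact: isometry_bounded.
  have -> // : V = W.
  by apply: tensor3r_eq Vb (isometry_bounded Wi) _ => *; rewrite Vg Wg.
have [||W [Wi Wg]] := @gram_extension R
  (tprod ot E (tprod ot F G)) (tprod ot (tprod ot E F) G) (E * F * G)
  (fun p => telt ot p.1.1 (telt ot p.1.2 p.2))
  (fun p => telt ot (telt ot p.1.1 p.1.2) p.2).
- by move=> p q; rewrite gram.
- rewrite -tensor3r_dense; congr (closure (lspan _)).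
  apply/seteqP; split=> [u [p ->]|u [x [y [h ->]]]].
    by exists p.1.1, p.1.2, p.2.
  by exists (x, y, h).
by exists W; split=> // x y h; exact: (Wg (x, y, h)).
Qed.

Lemma assoc_invK : cancel (assoc_inv ot E F G) (assoc ot E F G).
Proof.
have [ai aE] := assocP; have [bi bE] := assoc_invP.
suff e : assoc ot E F G \o assoc_inv ot E F G = id by move=> u; have := congr1 (fun f => f u) e.
apply: tensor3r_eq; [|exact: bounded_op_id|by move=> *; rewrite /= bE aE].
by apply: bounded_op_comp; exact: isometry_bounded.
Qed.

End Associator.

(** * Covariant representations *)

Section Unitary.
Context (R : realType) (H K : hilbert R) (f : H -> K).

(** The inverse relation on the range is isometric too and extends to all of [K]; followed by [f] it
    is the identity on a dense set, so [f] is onto. *)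
Lemma dense_range_unitary : is_isometry f ->
  closure [set y | exists x, f x = y] = setT -> Defs.is_unitary f.
Proof.
move=> fi dense; split=> // y.
have [|||g [gl gn gf]] := @isometric_graph_extension R K H (fun y x => f x = y).
- by move=> c _ _ x x' <- <-; exact: fi.1.
- by move=> _ x <-; rewrite isometry_norm.
- exact: dense.
exists (g y); suff fg : f \o g = id by have := congr1 (fun h => h y) fg.
apply: (@bounded_op_eq _ _ _ _ _ [set y | exists x, f x = y]).
- apply: bounded_op_comp (isometry_bounded fi).
  by apply: isometry_bounded; exact: norm_preserving_isometry.
- exact: bounded_op_id.
- apply/seteqP; split=> // z _; have : closure [set y | exists x, f x = y] z by rewrite dense.
  by apply: closure_subset => u; exact: lspan_gen.
- by move=> _ [x <-] /=; rewrite (gf _ x).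
Qed.

(** A right inverse of [f] is an adjoint of it, so [adj f] is a true adjoint and not the default;
    testing against the range of [f] then determines it. *)
Lemma unitary_adjK : Defs.is_unitary f -> cancel (adj f) f.
Proof.
move=> [[_ fi] fs] y; have /choice[g fg] := fs.
have fadj : is_adjoint f (adj f).
  apply: (@xgetPex _ (fun=> 0) [set g | is_adjoint f g]); exists g => x z /=.
  by rewrite -[z in LHS]fg fi.
apply: hip_inj => z; have [x <-] := fs z.
by rewrite /hip fi -fadj.
Qed.

Lemma unitary_adj_isometry : Defs.is_unitary f -> is_isometry (adj f).
Proof.
move=> fu; have fK := unitary_adjK fu; have [[fl fi] _] := fu.
have finj : injective f.
  move=> x y fxy; apply/eqP; rewrite -subr_eq0 -normr_eq0.
  by rewrite -(isometry_norm fu.1) linB // fxy subrr normr0.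
split=> [c x y|x y]; last by rewrite -fi !fK.
by apply: finj; rewrite fl !fK.
Qed.

End Unitary.

Section Covariant.
Context (R : realType) (ot : tensor_product R) (A : cstarAlg R) (E : corr A A)
  (H : hilbert R) (s : left_action A H) (T : E -> H -> H).

Lemma tildeP : (forall x y h k, hip (T x h) (T y k) = hip h (s (ip x y) k)) ->
  is_isometry (tilde ot s T) /\
  forall (x : E) (h : Corr s), tilde ot s T (telt ot x h) = T x h.
Proof.
move=> gram; have [|W [Wi Wg]] := @tensor_isometry R ot A A E (Corr s) H T.
  exact: gram.
by rewrite /tilde (xget_isometry Wi Wg).
Qed.

Hypothesis ic : isometric_covariant ot s T.

Lemma ic_hip x y h k : hip (T x h) (T y k) = hip h (s (ip x y) k).
Proof.
rewrite -!(ic_tilde ic) /hip (ic_isometry ic).2.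
exact: (@hip_telt R ot A A E (Corr s)).
Qed.

Lemma ic_norm x h : `|T x h| <= 2 * `|x| * `|h|.
Proof.
rewrite -(ic_tilde ic) (isometry_norm (ic_isometry ic)).
exact: (@norm_telt R ot A A E (Corr s)).
Qed.

(** [ic_covariant] carries a right factor [b]; by nondegeneracy it suffices to treat vectors
    [s b k], where balancing moves [b] over to [x]. *)
Lemma ic_lact a x h : T (corr_act E a x) h = s a (T x h).
Proof.
have -> // : T (corr_act E a x) = s a \o T x.
apply: bounded_op_eq (ic_bounded ic _) _ (lact_nondegenerate s) _.
  by apply: bounded_op_comp; [exact: (ic_bounded ic)|exact: lact_bounded].
move=> _ [b [k ->]] /=; rewrite -(ic_covariant ic) -!(ic_tilde ic).
congr (tilde _ _ _ _).
exact: (esym (tens_balanced (@ot _ _ _ E (Corr s)) _ b k)).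
Qed.

(** This is the intertwining condition under which [tid] of [tilde ot s T] has the expected values
    on elementary tensors. *)
Lemma tilde_lact a u :
  tilde ot s T (corr_act (tprod ot E (Corr s)) a u) = s a (tilde ot s T u).
Proof.
suff e : tilde ot s T \o corr_act (tprod ot E (Corr s)) a = s a \o tilde ot s T.
  by have := congr1 (fun f => f u) e.
have tb := isometry_bounded (ic_isometry ic).
apply: tensor_eq; [exact: bounded_op_comp (lact_bounded _ _) tb|
  exact: bounded_op_comp tb (lact_bounded _ _)|].
move=> x h /=; rewrite /telt tens_lact -!/(telt _ _ _) !(ic_tilde ic).
exact: ic_lact.
Qed.

End Covariant.

Section Composition.
Context (R : realType) (ot : tensor_product R) (A : cstarAlg R)
  (E F : corr A A) (H : hilbert R) (s : left_action A H).
Context (T : E -> H -> H) (S : F -> H -> H).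
Hypotheses (icT : isometric_covariant ot s T) (icS : isometric_covariant ot s S).

Lemma tid_tildeP :
  is_isometry (tid ot E (tprod ot F (Corr s)) (Corr s) (tilde ot s S)) /\
  forall x u, tid ot E (tprod ot F (Corr s)) (Corr s) (tilde ot s S)
    (telt ot x u) = telt ot x (tilde ot s S u : Corr s).
Proof.
apply: (@tidP R ot A A E (tprod ot F (Corr s)) (Corr s)).
  exact: (ic_isometry icS).
exact: (tilde_lact icS).
Qed.

(** The operator with values [T x (S y h)] on triple tensors, in the form in which it enters
    [tw_comm]. *)
Definition tilde2 : tprod ot (tprod ot E F) (Corr s) -> H :=
  tilde ot s T \o tid ot E (tprod ot F (Corr s)) (Corr s) (tilde ot s S)
    \o assoc ot E F (Corr s).

Lemma tilde2_bounded : bounded_op tilde2.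
Proof.
apply: bounded_op_comp; first exact: isometry_bounded (assocP ot E F (Corr s)).1.
apply: bounded_op_comp; first exact: isometry_bounded tid_tildeP.1.
exact: isometry_bounded (ic_isometry icT).
Qed.

Lemma tilde2E x y (h : Corr s) :
  tilde2 (telt ot (telt ot x y : tprod ot E F) h) = T x (S y h).
Proof.
rewrite /tilde2 /= (assocP ot E F (Corr s)).2 tid_tildeP.2.
by rewrite (ic_tilde icS) (ic_tilde icT).
Qed.

End Composition.
Arguments tilde2 {R} ot {A E F H} s T S _.

(** * From unitarity to the doubly twisted relation *)

Section FullyCoisometric.
Context (R : realType) (ot : tensor_product R) (A : cstarAlg R) (k : nat)
  (E : product_system ot A k) (H : hilbert R) (s : left_action A H)
  (T : forall i, E i -> H -> H) (U : 'I_k -> 'I_k -> H -> H).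

Lemma unitary_doubly_twisted : twisted_representation s T U ->
  (forall j, Defs.is_unitary (tilde ot s (@T j))) -> doubly_twisted s T U.
Proof.
move=> tw un; split=> // i j ij; apply/funext => u /=.
have ic l := tw_isometric tw l.
have Tinj l : injective (tilde ot s (@T l)).
  move=> x y fxy; apply/eqP; rewrite -subr_eq0 -normr_eq0.
  rewrite -(isometry_norm (ic_isometry (ic l))) linB ?fxy ?subrr ?normr0 //.
  exact: (ic_isometry (ic l)).1.
(* After applying the injective [T~_j], the left side is [T~_i u] and the right side is that of
   [tw_comm] at [assoc_inv v]. *)
apply: (Tinj j); rewrite unitary_adjK //.
set v := tid _ _ _ _ _ u.
have := congr1 (fun f => f (assoc_inv ot (E i) (E j) (Corr s) v)) (tw_comm tw ij).
move=> /= <-; rewrite assoc_invK /v; congr (tilde _ _ _ _).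
(* The inverse of an intertwiner intertwines, which gives [tid] of the adjoint its values on
   elementary tensors. *)
have adj_lact a h : adj (tilde ot s (@T j)) (s a h) =
    corr_act (tprod ot (E j) (Corr s)) a (adj (tilde ot s (@T j)) h).
  by apply: (Tinj j); rewrite unitary_adjK // tilde_lact // unitary_adjK.
have [ai aE] := @tidP R ot A A (E i) (Corr s) (tprod ot (E j) (Corr s)) _
  (unitary_adj_isometry (un j)) adj_lact.
have [bi bE] := tid_tildeP (E i) (ic j).
suff e : tid ot (E i) (tprod ot (E j) (Corr s)) (Corr s) (tilde ot s (@T j)) \o
    tid ot (E i) (Corr s) (tprod ot (E j) (Corr s)) (adj (tilde ot s (@T j))) = id.
  by have := congr1 (fun f => f u) e.
apply: tensor_eq; [|exact: bounded_op_id|].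
  by apply: bounded_op_comp; exact: isometry_bounded.
by move=> x h /=; rewrite aE bE unitary_adjK.
Qed.

End FullyCoisometric.

(** * Direct limits of Hilbert spaces *)

Section DirectLimit.
Context (R : realType) (I : Type) (le : I -> I -> Prop)
  (le_directed : directed_set le) (D : direct_system R le) (L : hilbert R)
  (psi : forall m, D m -> L) (L_limit : is_direct_limit psi).

Lemma psi_isometry m : is_isometry (@psi m).
Proof. exact: dl_isometry L_limit m. Qed.

Lemma psi_phi m n h : le m n -> psi (ds_phi D n m h) = psi h.
Proof. by move=> mn; rewrite -(dl_compat L_limit mn). Qed.

Lemma limit_dense : closure (lspan [set x | exists m h, x = @psi m h]) = setT.
Proof.
apply/seteqP; split=> // x _.
have : closure [set x | exists m h, x = @psi m h] x by rewrite (dl_dense L_limit).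
by apply: closure_subset => y; exact: lspan_gen.
Qed.

Lemma limit_eq (V : completeNormedModType R[i]) (f g : L -> V) :
  bounded_op f -> bounded_op g ->
  (forall m h, f (@psi m h) = g (@psi m h)) -> f = g.
Proof.
move=> fb gb fg; apply: bounded_op_eq fb gb limit_dense _.
by move=> _ [m [h ->]]; exact: fg.
Qed.

Lemma limit_pair m n (h : D m) (k : D n) :
  exists l (h' k' : D l), psi h = psi h' /\ psi k = psi k'.
Proof.
have [l [ml nl]] := dir_bound le_directed m n.
by exists l, (ds_phi D l m h), (ds_phi D l n k); rewrite !psi_phi.
Qed.

(** The universal property speaks of contractions, so the family is divided by [C + 1], nonzero even
    for [C = 0], and the resulting map is multiplied back. *)
Lemma limit_extension (K : hilbert R) (f : forall m, D m -> K) (C : R[i]) :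
  0 <= C -> (forall m, linear (@f m)) ->
  (forall m h, `|@f m h| <= C * `|h|) ->
  (forall m n h, le m n -> f n (ds_phi D n m h) = f m h) ->
  exists F : L -> K, bounded_op F /\ forall m h, F (@psi m h) = f m h.
Proof.
move=> C0 fl fC fphi; have C1 : 0 < C + 1 by rewrite ltr_wpDl.
have [m|m n mn|F [[[Fl Fn] FE] _]] :=
  @dl_universal _ _ _ _ _ _ L_limit K (fun m h => (C + 1)^-1 *: f m h).
- split=> [c x y|h]; first by rewrite fl scalerDr scalerA mulrC -scalerA.
  rewrite normrZ normfV (ger0_norm (ltW C1)) ler_pdivrMl //.
  by rewrite (le_trans (fC _ _)) // ler_wpM2r // lerDl.
- by apply/funext => h /=; rewrite fphi.
exists (fun x => (C + 1) *: F x); split=> [|m h].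
  apply: (@lipschitz_bounded_op _ _ _ _ (C + 1)).
    by move=> c x y; rewrite Fl scalerDr !scalerA mulrC.
  by move=> x; rewrite normrZ (ger0_norm (ltW C1)) ler_wpM2l // ltW.
have := congr1 (fun g => g h) (FE m); rewrite /= => ->.
by rewrite scalerA mulfV ?scale1r // gt_eqF.
Qed.

(** Density is used in one variable at a time, and [limit_pair] brings two vectors to a common
    level. Isometry, adjointness and Gram identities all have this form. *)
Lemma limit_hip_eq (K K' : hilbert R) (F G : L -> K) (P Q : L -> K') :
  bounded_op F -> bounded_op G -> bounded_op P -> bounded_op Q ->
  (forall m (h k : D m),
    hip (F (psi h)) (G (psi k)) = hip (P (psi h)) (Q (psi k))) ->
  forall x y, hip (F x) (G y) = hip (P x) (Q y).
Proof.
move=> Fb Gb Pb Qb eq_psi x y.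
have right m (h : D m) z : hip (F (psi h)) (G z) = hip (P (psi h)) (Q z).
  suff e : (fun z => hip (F (psi h)) (G z) : cplane R) =
      (fun z => hip (P (psi h)) (Q z) : cplane R) by have := congr1 (fun g => g z) e.
  apply: limit_eq; [exact: bounded_op_comp Gb (hip_bounded _)|
    exact: bounded_op_comp Qb (hip_bounded _)|move=> n k].
  by have [l [h' [k' [-> ->]]]] := limit_pair h k; exact: eq_psi.
rewrite -[LHS]hipC -[RHS]hipC; congr (_^*).
suff e : (fun x => hip (G y) (F x) : cplane R) =
    (fun x => hip (Q y) (P x) : cplane R) by have := congr1 (fun g => g x) e.
apply: limit_eq; [exact: bounded_op_comp Fb (hip_bounded _)|
  exact: bounded_op_comp Pb (hip_bounded _)|move=> n k].
by rewrite -hipC right hipC.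
Qed.

(** * Finite families in the limit and complete contractivity *)

Lemma directed_family n (ms : 'I_n -> I) : exists l, forall p, le (ms p) l.
Proof.
elim: n ms => [|n IHn] ms.
  by have [m] := dir_inhabited le_directed; exists m; case.
have [l ml] := IHn (fun p => ms (lift ord0 p)).
have [l' [ll' m0]] := dir_bound le_directed l (ms ord0).
exists l' => p; have [q ->|->] := unliftP ord0 p => //.
exact: (dir_trans le_directed (ml q) ll').
Qed.

Lemma limit_family_approx n (h : 'I_n -> L) (e : R[i]) : 0 < e ->
  exists m (g : 'I_n -> D m), forall p, `|h p - psi (g p)| < e.
Proof.
move=> e0; have approx p : exists mg : {m & D m}, `|h p - psi (projT2 mg)| < e.
  have /closure_normP/(_ e e0)[_ [m [g ->]] hg] :
      closure [set x | exists m h, x = @psi m h] (h p).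
    by rewrite (dl_dense L_limit).
  by exists (existT _ m g).
have /choice[mg hmg] := approx; have [l ml] := directed_family (fun p => projT1 (mg p)).
exists l, (fun p => ds_phi D l _ (projT2 (mg p))) => p.
by rewrite psi_phi.
Qed.

(** Continuity of [f] at [h] is expressed by filters converging in each coordinate, so no topology
    on families is involved. *)
Lemma limit_family_ge0 n (f : ('I_n -> L) -> R[i]) (h : 'I_n -> L) :
  (forall y, f y \is Num.real) ->
  (forall F : set_system ('I_n -> L), Filter F ->
    (forall p, (fun y => y p) @ F --> h p) ->
    (fun y => f y : R[i]^o) @ F --> (f h : R[i]^o)) ->
  (forall m (g : 'I_n -> D m), 0 <= f (fun p => psi (g p))) -> 0 <= f h.
Proof.
move=> fr fc fpsi.
(* The basic sets consist of families lying at a single level and within a real radius [r] of [h] in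
   each coordinate. *)
pose F : set_system ('I_n -> L) := filter_from [set r : R | 0 < r] (fun r =>
  [set y | (exists m (g : 'I_n -> D m), y = fun p => psi (g p)) /\
    forall p, `|h p - y p| < r%:C%C]).
have FF : Filter F.
  apply: filter_from_filter; first by exists 1; rewrite /= ltr01.
  move=> r s /= r0 s0; exists (Num.min r s); first by rewrite /= lt_min r0.
  move=> y [yg hy]; split; split=> // p; apply: lt_le_trans (hy p) _.
    by rewrite lecR ge_min lexx.
  by rewrite lecR ge_min lexx orbT.
have PF : ProperFilter F.
  apply: filter_from_proper => r /= r0.
  have [|m [g hg]] := @limit_family_approx n h r%:C%C; first by rewrite ltcR.
  by exists (fun p => psi (g p)); split=> //; exists m, g.
have ev p : (fun y => y p) @ F --> h p.
  apply/cvgrPdist_lt => e e0.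
  have er : e = (complex.Re e)%:C%C by rewrite RRe_real ?gtr0_real.
  exists (complex.Re e); first by rewrite /= -ltcR -er.
  by move=> y [_ /(_ p)]; rewrite -er.
have [//|f0] := real_leP (real0 _) (fr h).
(* If [f h] were negative, a nearby family at one level would have a value closer to [f h] than
   [- f h], hence negative as well. *)
have /cvgrPdist_lt/(_ (- f h)) := fc F FF ev.
rewrite oppr_gt0 => /(_ f0) nf.
have nF : F [set y | exists m (g : 'I_n -> D m), y = fun p => psi (g p)].
  by exists 1; rewrite /= ?ltr01 // => y [].
have [y [[m [g ->]] /=]] := filter_ex (filterI nF nf).
rewrite distrC ger0_norm; first by rewrite gtrDr le_gtF.
by rewrite subr_ge0 (le_trans (ltW f0)).
Qed.

Lemma sqnormE (K : hilbert R) n (v : 'I_n -> K) :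
  sqnorm v = \sum_p `|v p| ^+ 2.
Proof.
rewrite /sqnorm -[LHS]/(`|\sum_p ip (v p) (v p) : R[i]|).
rewrite (_ : (\sum_p ip (v p) (v p) : R[i]) = \sum_p `|v p| ^+ 2).
  by rewrite ger0_norm // sumr_ge0 // => p _; rewrite exprn_ge0.
by apply: eq_bigr => p _; exact: hip_norm.
Qed.

(** For fixed [X] and [c] the inequality says that a continuous real function of [h] is nonnegative;
    on families from one [D m] it is the complete contractivity of [T m]. *)
Lemma limit_completely_contractive (A : cstarAlg R) (E : hmodule A)
    (T : forall m, E -> D m -> D m) (T_oo : E -> L -> L) :
  (forall x, bounded_op (T_oo x)) ->
  (forall m x h, T_oo x (@psi m h) = psi (T m x h)) ->
  (forall m, completely_contractive (T m)) -> completely_contractive T_oo.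
Proof.
move=> Tb Tpsi Tcc n X c c0 Xc h; rewrite -subr_ge0.
pose f (y : 'I_n -> L) : R[i] := c ^+ 2 * \sum_p `|y p| ^+ 2
  - \sum_p `|\sum_q T_oo (X p q) (y q)| ^+ 2.
rewrite !sqnormE -/(f h); apply: limit_family_ge0.
- move=> y; rewrite /f rpredB // ger0_real //; first rewrite mulr_ge0 ?exprn_ge0 //.
    by apply: sumr_ge0 => p _; rewrite exprn_ge0.
  by apply: sumr_ge0 => p _; rewrite exprn_ge0.
- move=> F FF Fh; rewrite /f.
  have sq (g : 'I_n -> ('I_n -> L) -> L) (k : 'I_n -> L) :
      (forall p, g p @ F --> k p) ->
      (fun y => \sum_p `|g p y| ^+ 2 : R[i]^o) @ F --> (\sum_p `|k p| ^+ 2 : R[i]^o).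
    move=> gk; apply: cvg_big => [|p _]; first exact: add_continuous.
    rewrite expr2.
    under eq_fun do rewrite expr2.
    by apply: cvgM; apply: cvg_norm; exact: gk.
  apply: cvgB.
    by apply: cvgM; [exact: cvg_cst|exact: sq].
  apply: sq => p; apply: cvg_big => [|q _]; first exact: add_continuous.
  apply: (@cvg_comp _ _ _ (fun y : 'I_n -> L => y q) (T_oo (X p q))); first exact: Fh.
  exact: (Tb (X p q)).2.
- move=> m g; rewrite /f subr_ge0.
  have := Tcc m n X c c0 Xc g; rewrite !sqnormE.
  congr (_ <= _); last by congr (_ * _); apply: eq_bigr => p _; rewrite (isometry_norm (psi_isometry m)).
  apply: eq_bigr => p _; rewrite -(isometry_norm (psi_isometry m)); congr (`|_| ^+ 2).
  rewrite -[RHS]/(\sum_q _).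
  pose ps := linear_of (psi_isometry m).1.
  rewrite -[LHS]/(ps _) raddf_sum; apply: eq_bigr => q _; exact: esym (Tpsi _ _ _).
Qed.

End DirectLimit.

(** * Limits of covariant representations *)

Section LimitRepresentation.
Context (R : realType) (ot : tensor_product R) (A : cstarAlg R)
  (I : Type) (le : I -> I -> Prop)
  (le_directed : directed_set le) (D : direct_system R le) (L : hilbert R)
  (psi : forall m, D m -> L) (L_limit : is_direct_limit psi)
  (sigma : forall m, left_action A (D m)).

Let iso m : is_isometry (@psi m) := psi_isometry L_limit m.
Let psib m : bounded_op (@psi m) := isometry_bounded (iso m).

Lemma limit_left_action :
  (forall m n h a, le m n ->
    ds_phi D n m (sigma m a h) = sigma n a (ds_phi D n m h)) ->
  exists sigma_oo : left_action A L,
    forall m a h, sigma_oo a (@psi m h) = psi (sigma m a h).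
Proof.
move=> phi_sigma.
have /choice[s sP] a : exists F : L -> L, bounded_op F /\
    forall m h, F (@psi m h) = psi (sigma m a h).
  apply: (@limit_extension _ _ _ _ _ _ L_limit L
    (fun m h => psi (sigma m a h)) (2 * `|a|)).
  - by rewrite mulr_ge0.
  - by move=> m c x y; rewrite lactr (iso m).1.
  - by move=> m h; rewrite isometry_norm //; exact: norm_lact.
  - by move=> m n h mn; rewrite -phi_sigma // (psi_phi L_limit).
have sb a := (sP a).1; have spsi a := (sP a).2.
(* Each algebraic law for [s] is thereby reduced to the same law for [sigma m] on the vectors
   [psi m h]. *)
have seq a (f : L -> L) : bounded_op f ->
    (forall m h, f (@psi m h) = psi (sigma m a h)) -> forall x, s a x = f x.
  move=> fb fpsi x; suff -> : s a = f by [].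
  by apply: (limit_eq L_limit (sb a) fb) => m h; rewrite spsi fpsi.
have sD a b x : s (a + b) x = s a x + s b x.
  apply: (seq _ (fun x => s a x + s b x)) => [|m h]; first exact: bounded_opD.
  by rewrite !spsi lactD (linD (iso m).1).
have sZ (c : R[i]) a x : s (c *: a) x = c *: s a x.
  apply: (seq _ (fun x => c *: s a x)) => [|m h]; first exact: bounded_opZ.
  by rewrite !spsi lactZ (linZ (iso m).1).
have sM a b x : s (cmul a b) x = s a (s b x).
  apply: (seq _ (s a \o s b)) => [|m h]; first exact: bounded_op_comp.
  by rewrite /= !spsi lactM.
have sA a : is_adjoint (s a) (s (cstar a)).
  apply: (limit_hip_eq le_directed L_limit (F := s a) (G := id) (P := id)
    (Q := s (cstar a))) => //; try exact: bounded_op_id.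
  move=> m h k; rewrite !spsi /hip !(iso m).2; exact: (lact_adjoint (sigma m) a h k).
have sN : closure (lspan [set y | exists a x, y = s a x]) = setT.
  (* [psi m] carries the vectors [sigma m a k], whose span is dense in [D m], to vectors
     [s a (psi m k)]. *)
  apply: lspan_dense_sub (limit_dense L_limit) _ => _ [m [h ->]].
  have := bounded_closure_lspan (psib m) (S := [set y | exists a x, y = sigma m a x]) (x := h).
  rewrite (lact_nondegenerate (sigma m)) => /(_ Logic.I).
  apply: closure_lspan_sub => _ [_ [a [k ->]] <-].
  by apply: subset_closure; apply: lspan_gen; exists a, (psi k); rewrite spsi.
by exists (LeftAction sb sD sZ sM sA sN).
Qed.

Context (sigma_oo : left_action A L).
Hypothesis sigma_psi :
  forall m a h, sigma_oo a (@psi m h) = psi (sigma m a h).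

Let tid_psi (E : corr A A) m := @tidP R ot A A E (Corr (sigma m)) (Corr sigma_oo)
  (@psi m) (iso m) (fun a h => esym (sigma_psi a h)).

(** [ic_norm] bounds the operators [T m x] by [2 |x|] uniformly in [m]; the Gram identity passes to
    the limit and gives the isometry on the tensor product. *)
Lemma limit_covariant (E : corr A A) (T : forall m, E -> D m -> D m) :
  (forall m, isometric_covariant ot (sigma m) (T m)) ->
  (forall m n x h, le m n ->
    ds_phi D n m (T m x h) = T n x (ds_phi D n m h)) ->
  exists T_oo : E -> L -> L, isometric_covariant ot sigma_oo T_oo /\
    forall m x h, T_oo x (@psi m h) = psi (T m x h).
Proof.
move=> ic phi_T.
have /choice[S SP] x : exists F : L -> L, bounded_op F /\
    forall m h, F (@psi m h) = psi (T m x h).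
  apply: (@limit_extension _ _ _ _ _ _ L_limit L
    (fun m h => psi (T m x h)) (2 * `|x|)).
  - by rewrite mulr_ge0.
  - by move=> m c y z; rewrite (ic_bounded (ic m) x).1 (iso m).1.
  - by move=> m h; rewrite isometry_norm //; exact: (ic_norm (ic m)).
  - by move=> m n h mn; rewrite -phi_T // (psi_phi L_limit).
have Sb x := (SP x).1; have Spsi m x h : S x (@psi m h) = psi (T m x h) := (SP x).2 m h.
have Seq x (f : L -> L) : bounded_op f ->
    (forall m h, f (@psi m h) = psi (T m x h)) -> forall h, S x h = f h.
  move=> fb fpsi h; suff -> : S x = f by [].
  by apply: (limit_eq L_limit (Sb x) fb) => m k; rewrite Spsi fpsi.
exists S; split=> //.
have gram x y h k : hip (S x h) (S y k) = hip h (sigma_oo (ip x y) k).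
  apply: (limit_hip_eq le_directed L_limit (F := S x) (G := S y) (P := id)
    (Q := sigma_oo (ip x y))) => //; first exact: bounded_op_id.
    exact: lact_bounded.
  move=> m {}h {}k; rewrite !Spsi sigma_psi /hip !(iso m).2.
  exact: ic_hip (ic m) _ _ _ _.
have [ti tE] := tildeP ot gram.
split=> //.
- move=> h c x y; apply: (Seq _ (fun h => c *: S x h + S y h)) => [|m k].
    by apply: bounded_opD => //; exact: bounded_opZ.
  by rewrite !Spsi (ic_linear (ic m)) (iso m).1.
- exact: (limit_completely_contractive le_directed L_limit Sb Spsi
    (fun m => ic_cc (ic m))).
- move=> a x b h.
  apply: (Seq _ (sigma_oo a \o (S x \o sigma_oo b))) => [|m k].
    apply: bounded_op_comp; last exact: lact_bounded.
    by apply: bounded_op_comp => //; exact: lact_bounded.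
  by rewrite /= sigma_psi Spsi sigma_psi (ic_covariant (ic m)).
Qed.

Lemma limit_tilde (E : corr A A) (T : forall m, E -> D m -> D m)
    (T_oo : E -> L -> L) :
  (forall m, isometric_covariant ot (sigma m) (T m)) ->
  isometric_covariant ot sigma_oo T_oo ->
  (forall m x h, T_oo x (@psi m h) = psi (T m x h)) ->
  forall m, @psi m \o tilde ot (sigma m) (T m) = tilde ot sigma_oo T_oo \o
    tid ot E (Corr (sigma m)) (Corr sigma_oo) (@psi m).
Proof.
move=> ic ic_oo T_psi m; have [ti tE] := tid_psi E m.
apply: tensor_eq.
- exact: bounded_op_comp (isometry_bounded (ic_isometry (ic m))) (psib m).
- exact: bounded_op_comp (isometry_bounded ti) (isometry_bounded (ic_isometry ic_oo)).
by move=> x h /=; rewrite tE (ic_tilde (ic m)) (ic_tilde ic_oo) T_psi.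
Qed.

(** [u] is a general element of the tensor product, because a twist need not send elementary tensors
    to elementary tensors. *)
Lemma limit_tilde2 (E F : corr A A) (T : forall m, E -> D m -> D m)
    (T_oo : E -> L -> L) (S : forall m, F -> D m -> D m) (S_oo : F -> L -> L) :
  (forall m, isometric_covariant ot (sigma m) (T m)) ->
  isometric_covariant ot sigma_oo T_oo ->
  (forall m x h, T_oo x (@psi m h) = psi (T m x h)) ->
  (forall m, isometric_covariant ot (sigma m) (S m)) ->
  isometric_covariant ot sigma_oo S_oo ->
  (forall m x h, S_oo x (@psi m h) = psi (S m x h)) ->
  forall m u (h : Corr (sigma m)),
    tilde2 ot sigma_oo T_oo S_oo (telt ot u (psi h : Corr sigma_oo)) =
    psi (tilde2 ot (sigma m) (T m) (S m) (telt ot u h)).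
Proof.
move=> icT icT_oo T_psi icS icS_oo S_psi m u h.
suff e : tilde2 ot sigma_oo T_oo S_oo \o
    (fun u => telt ot u (psi h : Corr sigma_oo)) =
    @psi m \o (tilde2 ot (sigma m) (T m) (S m) \o (fun u => telt ot u h)).
  by have := congr1 (fun f => f u) e.
apply: bounded_op_eq _ _ (tens_dense (@ot _ _ _ E F)) _.
- exact: bounded_op_comp (telt_boundedl _ _ _) (tilde2_bounded icT_oo icS_oo).
- apply: bounded_op_comp (psib m).
  exact: bounded_op_comp (telt_boundedl _ _ _) (tilde2_bounded (icT m) (icS m)).
move=> _ [x [y ->]] /=; by rewrite -/(telt _ _ _) !tilde2E // S_psi T_psi.
Qed.

(** By [limit_tilde] the range of [T~_oo] contains every [psi n (T~_n u)], and by hypothesis these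
    include the dense union of the ranges of the [psi m]. *)
Lemma limit_coisometry (E : corr A A) (T : forall m, E -> D m -> D m)
    (T_oo : E -> L -> L) :
  (forall m, isometric_covariant ot (sigma m) (T m)) ->
  isometric_covariant ot sigma_oo T_oo ->
  (forall m x h, T_oo x (@psi m h) = psi (T m x h)) ->
  (forall m (h : D m), exists n u, psi (tilde ot (sigma n) (T n) u) = psi h) ->
  Defs.is_unitary (tilde ot sigma_oo T_oo).
Proof.
move=> ic ic_oo T_psi range; apply: dense_range_unitary (ic_isometry ic_oo) _.
apply/seteqP; split=> // y _.
have : closure [set x | exists m h, x = @psi m h] y by rewrite (dl_dense L_limit).
apply: closure_subset => _ [m [h ->]]; have [n [u <-]] := range m h.
exists (tid ot E (Corr (sigma n)) (Corr sigma_oo) (@psi n) u).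
by have := congr1 (fun f => f u) (limit_tilde ic ic_oo T_psi n).
Qed.

End LimitRepresentation.

(** * Construction of the limit representation *)

Lemma is_unitary_adjK (R : realType) (H : hilbert R) (f g : H -> H) :
  Defs.is_unitary f -> is_adjoint f g -> cancel f g.
Proof. by move=> [[_ fi] _] fg x; apply: hip_inj => y; rewrite /hip -fg fi. Qed.
Theorem theorem8p7 (R : realType) (ot : tensor_product R) (A : cstarAlg R)
    (k : nat) (E : product_system ot A k)
    (I : Type) (le : I -> I -> Prop) (le_directed : directed_set le)
    (D : direct_system R le) (L : hilbert R) (psi : forall m, D m -> L)
    (L_limit : is_direct_limit psi)
    (sigma : forall m, left_action A (D m))
    (T : forall m i, E i -> D m -> D m)
    (U : forall m, 'I_k -> 'I_k -> D m -> D m)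
    (TU_doubly_twisted : forall m, doubly_twisted (sigma m) (T m) (U m))
    (phi_tilde : forall m n, le m n -> forall i,
       ds_phi D n m \o tilde ot (sigma m) (T m i) =
       tilde ot (sigma n) (T n i) \o
         tid ot (E i) (Corr (sigma m)) (Corr (sigma n)) (ds_phi D n m))
    (phi_U : forall m n, le m n -> forall i j, i != j ->
       ds_phi D n m \o U m i j = U n i j \o ds_phi D n m)
    (phi_sigma : forall m n, le m n -> forall a,
       ds_phi D n m \o sigma m a = sigma n a \o ds_phi D n m) :
  exists (sigma_oo : left_action A L) (T_oo : forall i, E i -> L -> L)
    (U_oo : 'I_k -> 'I_k -> L -> L),
    let tT m i := tilde ot (sigma m) (T m i) in
    let tT_oo i := tilde ot sigma_oo (T_oo i) in
    let exhausted j := forall m, exists n, [/\ le m n, n <> m &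
      tT n j \o adj (tT n j) \o ds_phi D n m = ds_phi D n m] in
    let all_coisometric j := forall n, is_coisometry (tT n j) in
    [/\ twisted_representation sigma_oo T_oo U_oo,
      (forall m,
        [/\ forall i, psi m \o tT m i =
               tT_oo i \o tid ot (E i) (Corr (sigma m)) (Corr sigma_oo) (psi m),
            forall i x, T_oo i x \o psi m = psi m \o T m i x,
            forall i j, i != j -> psi m \o U m i j = U_oo i j \o psi m &
            forall a, psi m \o sigma m a = sigma_oo a \o psi m]),
      (forall j, exhausted j -> is_coisometry (tT_oo j)),
      (forall j, all_coisometric j -> is_coisometry (tT_oo j)) &
      ((forall j, exhausted j \/ all_coisometric j) ->
        fully_coisometric sigma_oo T_oo /\
        doubly_twisted sigma_oo T_oo U_oo)].

Proof.
have tw m := (TU_doubly_twisted m).1.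
have ic m i := tw_isometric (tw m) i.
have phi_s m n h a : le m n ->
    ds_phi D n m (sigma m a h) = sigma n a (ds_phi D n m h).
  by move=> mn; have := congr1 (fun f => f h) (phi_sigma m n mn a).
have [sigma_oo sigma_psi] := limit_left_action le_directed L_limit phi_s.
have phi_T i m n x h : le m n ->
    ds_phi D n m (T m i x h) = T n i x (ds_phi D n m h).
  move=> mn; have [_ tE] := @tidP R ot A A (E i) (Corr (sigma m)) (Corr (sigma n))
    _ (ds_isometry D mn) (fun a h => phi_s m n h a mn).
  have := congr1 (fun f => f (telt ot x (h : Corr (sigma m)))) (phi_tilde m n mn i).
  by rewrite /= tE (ic_tilde (ic m i)) (ic_tilde (ic n i)).
have TP i := limit_covariant le_directed L_limit sigma_psi
  (fun m => ic m i) (phi_T i).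
(* The type of [T_oo i] depends on [i] through [E i], so the operator is chosen for each [i]
   separately. *)
pose T_oo i := sval (cid (TP i)).
have ic_oo i : isometric_covariant ot sigma_oo (T_oo i) := (svalP (cid (TP i))).1.
have T_psi i m x h : T_oo i x (psi m h) = psi m (T m i x h) :=
  (svalP (cid (TP i))).2 m x h.
(* The pair [p] indexes the limit twists; on the diagonal the identity serves as a bounded default
   value. *)
have /choice[V VP] p : exists F : L -> L, bounded_op F /\
    (p.1 != p.2 -> forall m h, F (psi m h) = psi m (U m p.1 p.2 h)).
  case: p => i j /=; have [->|ij] := eqVneq i j.
    by exists id; split=> //; exact: bounded_op_id.
  have [||||F [Fb FE]] := @limit_extension _ _ _ _ _ _ L_limit L
    (fun m h => psi m (U m i j h)) 1; last by exists F.
  - exact: ler01.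
  - move=> m c x y; rewrite (tw_unitary (tw m) ij).1.1.
    exact: (psi_isometry L_limit m).1.
  - move=> m h; rewrite (isometry_norm (psi_isometry L_limit m)) mul1r.
    by rewrite (isometry_norm (tw_unitary (tw m) ij).1).
  - move=> m n h mn; rewrite -(psi_phi L_limit _ mn); congr (psi n _).
    by have := congr1 (fun f => f h) (phi_U m n mn i j ij).
pose U_oo i j := V (i, j).
have Ub i j : bounded_op (U_oo i j) := (VP (i, j)).1.
have U_psi i j m h : i != j -> U_oo i j (psi m h) = psi m (U m i j h).
  by move=> ij; exact: (VP (i, j)).2.
(* At each level [U m i j] is the adjoint of the unitary [U m j i], hence its inverse. *)
have U_inv i j : i != j -> U_oo i j \o U_oo j i = id.
  move=> ij; have ji : j != i by rewrite eq_sym.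
  apply: (limit_eq L_limit).
  - exact: bounded_op_comp.
  - exact: bounded_op_id.
  move=> m h /=; rewrite !U_psi //; congr (psi m _).
  exact: (is_unitary_adjK (tw_unitary (tw m) ji) (tw_adjoint (tw m) ji)).
have U_iso i j : i != j -> is_isometry (U_oo i j).
  move=> ij; split; first exact: (Ub i j).1.
  apply: (limit_hip_eq le_directed L_limit (F := U_oo i j) (G := U_oo i j)
    (P := id) (Q := id)) => //; try exact: bounded_op_id.
  move=> m h h'; rewrite !U_psi // /hip !(psi_isometry L_limit m).2.
  exact: (tw_unitary (tw m) ij).1.2.
have U_sigma i j a : i != j -> U_oo i j \o sigma_oo a = sigma_oo a \o U_oo i j.
  move=> ij; have sb := lact_bounded sigma_oo a.
  apply: (limit_eq L_limit); try exact: bounded_op_comp.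
  move=> m h /=; rewrite sigma_psi !U_psi // sigma_psi; congr (psi m _).
  by have := congr1 (fun f => f h) (tw_sigma (tw m) a ij).
have U_sigmaE i j a h : i != j -> U_oo i j (sigma_oo a h) = sigma_oo a (U_oo i j h).
  by move=> ij; have := congr1 (fun f => f h) (U_sigma i j a ij).
have twP : twisted_representation sigma_oo T_oo U_oo.
  split=> //.
  - move=> i j ij; split; first exact: U_iso.
    by move=> y; exists (U_oo j i y); have := congr1 (fun f => f y) (U_inv i j ij).
  - move=> i j ij; apply: (limit_hip_eq le_directed L_limit (F := U_oo i j)
      (G := id) (P := id) (Q := U_oo j i)) => //; try exact: bounded_op_id.
    move=> m h h'; rewrite !U_psi // 1?eq_sym // /hip !(psi_isometry L_limit m).2.
    exact: (tw_adjoint (tw m) ij).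
  - move=> i j l ij.
    have [ti tE] := @tidP R ot A A (E l) (Corr sigma_oo) (Corr sigma_oo)
      _ (U_iso i j ij) (fun a h => U_sigmaE i j a h ij).
    have tb := isometry_bounded (ic_isometry (ic_oo l)).
    apply: tensor_eq.
    + exact: bounded_op_comp tb (Ub i j).
    + exact: bounded_op_comp (isometry_bounded ti) tb.
    move=> x h /=; rewrite tE !(ic_tilde (ic_oo l)).
    (* On elementary tensors the relation says that [U_oo i j] commutes with [T_oo l x], which is
       checked level by level. *)
    suff e : U_oo i j \o T_oo l x = T_oo l x \o U_oo i j by have := congr1 (fun f => f h) e.
    have Tb := ic_bounded (ic_oo l) x.
    apply: (limit_eq L_limit); try exact: bounded_op_comp.
    move=> m {}h /=; rewrite T_psi !U_psi // T_psi; congr (psi m _).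
    have [_ tmE] := @tidP R ot A A (E l) (Corr (sigma m)) (Corr (sigma m))
      _ (tw_unitary (tw m) ij).1
      (fun a h => congr1 (fun f => f h) (tw_sigma (tw m) a ij)).
    have := congr1 (fun f => f (telt ot x (h : Corr (sigma m)))) (tw_tilde (tw m) l ij).
    by rewrite /= tmE !(ic_tilde (ic m l)).
  - move=> i j ij.
    change (tilde2 ot sigma_oo (T_oo i) (T_oo j) =
      tilde2 ot sigma_oo (T_oo j) (T_oo i) \o
      tmap ot (tprod ot (E i) (E j)) (tprod ot (E j) (E i))
        (Corr sigma_oo) (Corr sigma_oo) (ps_t E i j) (U_oo i j)).
    have t_iso := ps_t_unitary E i j.
    have [ti tE] := @tmapP R ot A A (tprod ot (E i) (E j)) (tprod ot (E j) (E i))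
      (Corr sigma_oo) (Corr sigma_oo) (ps_t E i j) _ t_iso.1.2 (U_iso i j ij)
      (fun a h => U_sigmaE i j a h ij).
    have b2 i j := tilde2_bounded (ic_oo i) (ic_oo j).
    apply: tensor_eq; [exact: b2|exact: bounded_op_comp (isometry_bounded ti) (b2 j i)|].
    move=> u h /=; rewrite tE.
    (* With [u] fixed, both sides are bounded in [h], so [h] may be taken in the range of some
       [psi m], where [tw_comm] at level [m] applies. *)
    suff e : tilde2 ot sigma_oo (T_oo i) (T_oo j) \o (fun h => telt ot u (h : Corr sigma_oo)) =
        tilde2 ot sigma_oo (T_oo j) (T_oo i) \o
        ((fun h => telt ot (ps_t E i j u) (h : Corr sigma_oo)) \o U_oo i j).
      by have := congr1 (fun f => f h) e.
    apply: (limit_eq L_limit).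
    + exact: bounded_op_comp (telt_boundedr _ _ _) (b2 i j).
    + apply: bounded_op_comp (b2 j i).
      exact: bounded_op_comp (Ub i j)
        (telt_boundedr ot (Corr sigma_oo) (ps_t E i j u)).
    move=> m {}h /=; rewrite U_psi //.
    have lim2 i j := limit_tilde2 L_limit (fun m => ic m i) (ic_oo i) (T_psi i)
      (fun m => ic m j) (ic_oo j) (T_psi j) .
    rewrite !lim2; congr (psi m _).
    have [_ tmE] := @tmapP R ot A A (tprod ot (E i) (E j)) (tprod ot (E j) (E i))
      (Corr (sigma m)) (Corr (sigma m)) (ps_t E i j) _ t_iso.1.2
      (tw_unitary (tw m) ij).1
      (fun a h => congr1 (fun f => f h) (tw_sigma (tw m) a ij)).
    have := congr1 (fun f => f (telt ot u (h : Corr (sigma m)))) (tw_comm (tw m) ij).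
    by rewrite /= /twist tmE.
have un j : (forall m (h : D m), exists n u,
    psi n (tilde ot (sigma n) (T n j) u) = psi m h) ->
    Defs.is_unitary (tilde ot sigma_oo (T_oo j)).
  exact: (limit_coisometry L_limit sigma_psi (fun m => ic m j) (ic_oo j) (T_psi j)).
have exh j : (forall m, exists n, [/\ le m n, n <> m &
      tilde ot (sigma n) (T n j) \o adj (tilde ot (sigma n) (T n j)) \o ds_phi D n m = ds_phi D n m]) ->
    Defs.is_unitary (tilde ot sigma_oo (T_oo j)).
  move=> ex; apply: un => m h; have [n [mn _ e]] := ex m.
  (* The vector [h], moved to level [n], is fixed by the range projection of [T~_{n,j}], so the
     adjoint supplies a preimage. *)
  exists n, (adj (tilde ot (sigma n) (T n j)) (ds_phi D n m h)).
  by rewrite -(psi_phi L_limit h mn); congr (psi n _); have := congr1 (fun f => f h) e.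
have coiso j : (forall n, is_coisometry (tilde ot (sigma n) (T n j))) ->
    Defs.is_unitary (tilde ot sigma_oo (T_oo j)).
  move=> co; apply: un => m h.
  by exists m, (adj (tilde ot (sigma m) (T m j)) h); rewrite co.
exists sigma_oo, T_oo, U_oo => tT tT_oo exhausted all_coisometric; split.
- exact: twP.
- move=> m; split.
  + move=> i; exact: (limit_tilde L_limit sigma_psi (fun m => ic m i) (ic_oo i) (T_psi i)).
  + by move=> i x; apply/funext => h /=; rewrite T_psi.
  + by move=> i j ij; apply/funext => h /=; rewrite U_psi.
  + by move=> a; apply/funext => h /=; rewrite sigma_psi.
- by move=> j /exh/unitary_adjK.
- by move=> j /coiso/unitary_adjK.
move=> ea; have unj j : Defs.is_unitary (tilde ot sigma_oo (T_oo j)).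
  by have [/exh|/coiso] := ea j.
split; first by move=> j; exact: unitary_adjK.
exact: unitary_doubly_twisted.
Qed.
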